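(* For each positive integer $n$, the annular semigroup $\mathfrak{A}_{2n-1}$ satisfies $c(\mathfrak{A}_{2n-1})=n-1$, where $c$ denotes Krohn--Rhodes complexity.
   Context: All semigroups are finite. Krohn--Rhodes complexity: a semigroup $S$ divides $T$ if $S$ is a homomorphic image of a subsemigroup of $T$. The (group or Krohn--Rhodes) complexity $c(S)$ is the least integer $m\ge 0$ such that $S$ divides an iterated wreath product $A_m\wr G_m\wr A_{m-1}\wr\cdots\wr A_1\wr G_1\wr A_0$, where the $G_i$ are finite groups and the $A_i$ are finite aperiodic semigroups (all of whose subgroups are trivial). (Here one may take $S\wr T=S^{T^I}\rtimes T$, where $T^I$ is $T$ with a new identity adjoined, with $(f,t)(g,u)=(h,tu)$, $h(x)=f(x)g(xt)$, and bracket iterated products to the right.) Brauer semigroup: for a positive integer $n$ let $[n]=\{1,\dots,n\}$, $[n]'=\{1',\dots,n'\}$, $[n]''=\{1'',\dots,n''\}$ be disjoint copies. The partition semigroup $\mathfrak{C}_n$ consists of all partitions (equivalently, equivalence relations) of $[n]\cup[n]'$. The product $\xi\eta$ is computed as follows: let $\eta'$ be the equivalence relation on $[n]'\cup[n]''$ obtained from $\eta$ by replacing each $k$ by $k'$ and each $k'$ by $k''$; take the equivalence relation on $[n]\cup[n]'\cup[n]''$ generated by $\xi\cup\eta'$; restrict it to $[n]\cup[n]''$; finally replace each $k''$ by $k'$. This makes $\mathfrak{C}_n$ a monoid. The Brauer semigroup $\mathfrak{B}_n$ is the subsemigroup of all elements all of whose blocks have size exactly $2$. Annular semigroup: consider the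 annulus $A=\{z\in\mathbb{C}\mid 1<|z|<2\}$ and identify $k\in[n]$ with $e^{2\pi i(k-1)/n}$ and $k'\in[n]'$ with $2e^{2\pi i(k-1)/n}$. An annular diagram of $\xi\in\mathfrak{B}_n$ is obtained by linking, for each block $\{x,y\}\in\xi$ with $x\neq y$, the points $x$ and $y$ by a path (string) running entirely in $A$ except for its endpoints. The annular semigroup $\mathfrak{A}_n$ is the subsemigroup of $\mathfrak{B}_n$ consisting of all elements that have an annular diagram in which any two distinct strings have empty intersection. *)

(* Defs.v *)
From HB Require Import structures.
From mathcomp Require Import all_boot all_order all_algebra all_fingroup.
From mathcomp Require Import all_classical all_reals all_analysis.
From mathcomp Require Import complex.

Set Implicit Arguments.
Unset Strict Implicit.
Unset Printing Implicit Defensive.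

Import Order.TTheory GRing.Theory Num.Theory.
Import numFieldNormedType.Exports.

Local Open Scope classical_set_scope.

Section WreathProduct.
Variables S T : semigroupType.

Definition wreath : Type := ((option T -> S) * T)%type.

HB.instance Definition _ := Choice.on wreath.

(* option T is T^I, with None as the adjoined identity. *)
Definition act (x : option T) (t : T) : option T :=
  if x is Some s then Some (s * t)%g else Some t.

Definition wreath_mul (p q : wreath) : wreath :=
  (fun x => (p.1 x * q.1 (act x p.2))%g, (p.2 * q.2)%g).

Lemma wreath_mulA : associative wreath_mul.
Proof.
move=> [f t] [g u] [h v]; rewrite /wreath_mul /= mulgA; congr pair.
apply/funext => x; rewrite mulgA; congr (_ * h _)%g.
by case: x => [s|] //=; rewrite mulgA.
Qed.

HB.instance Definition _ := isSemigroup.Build wreath wreath_mulA.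

End WreathProduct.

Definition subsemigroup (M : semigroupType) (S : set M) : Prop :=
  forall x y : M, S x -> S y -> S (x * y)%g.

Definition subgroup (M : semigroupType) (H : set M) : Prop :=
  subsemigroup H /\
  exists2 e : M, H e &
    forall x : M, H x ->
      [/\ (e * x)%g = x, (x * e)%g = x &
          exists2 y : M, H y & (x * y)%g = e /\ (y * x)%g = e].

Definition aperiodic (A : semigroupType) : Prop :=
  forall H : set A, subgroup H -> exists e : A, H = [set e].

(* The semigroup S is given as a subset of an ambient semigroup M; being the
   image of a morphism, it is then closed under products (divides_closed). *)
Definition divides (M : semigroupType) (S : set M) (T : semigroupType) : Prop :=
  exists (U : set T) (f : T -> M),
    [/\ subsemigroup U,
        forall x y : T, U x -> U y -> f (x * y)%g = (f x * f y)%g &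
        f @` U = S].

Lemma divides_closed (M : semigroupType) (S : set M) (T : semigroupType) :
  divides S T -> subsemigroup S.
Proof.
move=> [U [f [Uc fM <-]]] _ _ [x Ux <-] [y Uy <-].
by exists (x * y)%g; [exact: Uc | exact: fM].
Qed.

(* kr_product m W: W is a product A_m wr (G_m wr (... wr (G_1 wr A_0))). *)
Inductive kr_product : nat -> semigroupType -> Prop :=
| kr_product0 (A : semigroupType) :
    finite_set [set: A] -> aperiodic A -> kr_product 0 A
| kr_productS (m : nat) (A : semigroupType) (G : finGroupType)
    (W : semigroupType) :
    finite_set [set: A] -> aperiodic A -> kr_product m W ->
    kr_product m.+1 (wreath A (wreath G W)).

Definition divides_kr_product (M : semigroupType) (S : set M) (m : nat) : Prop :=
  exists2 W : semigroupType, kr_product m W & divides S W.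

(* has_complexity S m: c(S) = m. *)
Definition has_complexity (M : semigroupType) (S : set M) (m : nat) : Prop :=
  divides_kr_product S m /\
  forall k : nat, divides_kr_product S k -> (m <= k)%N.

Section PartitionSemigroup.
Variable n : nat.

(* inl k stands for k + 1 in [n], and inr k for (k + 1)' in [n]'. *)
Definition vertex : finType := ('I_n + 'I_n)%type.

Definition equivb (r : {set vertex * vertex}) : bool :=
  [&& [forall x, (x, x) \in r],
      [forall x, forall y, ((x, y) \in r) ==> ((y, x) \in r)] &
      [forall x, forall y, forall z,
        ((x, y) \in r) && ((y, z) \in r) ==> ((x, z) \in r)]].

Record partsg := Partsg { graph :> {set vertex * vertex}; _ : equivb graph }.

HB.instance Definition _ := [isSub for graph].
HB.instance Definition _ := [Finite of partsg by <:].

Implicit Types xi eta zeta : partsg.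

Definition related xi (x y : vertex) : bool := (x, y) \in graph xi.

Definition vertex3 : finType := ('I_n + 'I_n + 'I_n)%type.

(* Inclusions into [n] + [n]' + [n]'' of, respectively, [n] + [n]'; its shifted
   copy [n]' + [n]''; and [n] + [n]'' (identified with [n] + [n]'). *)
Definition emb_top (x : vertex) : vertex3 := inl x.
Definition emb_bot (x : vertex) : vertex3 :=
  match x with inl k => inl (inr k) | inr k => inr k end.
Definition emb_out (x : vertex) : vertex3 :=
  match x with inl k => inl (inl k) | inr k => inr k end.

Definition stack xi eta : {set vertex3 * vertex3} :=
  ([set (emb_top p.1, emb_top p.2) | p in graph xi] :|:
   [set (emb_bot p.1, emb_bot p.2) | p in graph eta])%SET.

(* stack xi eta is symmetric, so connect, its reflexive transitive closure, is
   the equivalence relation it generates. *)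
Definition partsg_mul_graph xi eta : {set vertex * vertex} :=
  [set p | connect (fun u v => (u, v) \in stack xi eta)
                   (emb_out p.1) (emb_out p.2)]%SET.

Lemma related_refl xi : reflexive (related xi).
Proof. by move=> x; have /and3P[/forallP/(_ x)] := valP xi. Qed.

Lemma related_sym xi x y : related xi x y -> related xi y x.
Proof.
by have /and3P[_ /forallP/(_ x)/forallP/(_ y)/implyP] := valP xi.
Qed.

Lemma related_trans xi y x z :
  related xi x y -> related xi y z -> related xi x z.
Proof.
have /and3P[_ _ /forallP/(_ x)/forallP/(_ y)/forallP/(_ z)/implyP rt] := valP xi.
by move=> xy yz; apply/rt/andP.
Qed.

Lemma stack_sym xi eta u v :
  ((u, v) \in stack xi eta) = ((v, u) \in stack xi eta).
Proof.
suff H a b : (a, b) \in stack xi eta -> (b, a) \in stack xi eta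
  by apply/idP/idP; exact: H.
rewrite !inE => /orP[] /imsetP[[x y] xy [-> ->]]; apply/orP; [left|right];
  by apply/imsetP; exists (y, x) => //; exact: related_sym.
Qed.

Lemma partsg_mul_equiv xi eta : equivb (partsg_mul_graph xi eta).
Proof.
have sc : connect_sym (fun u v => (u, v) \in stack xi eta).
  by apply: sym_connect_sym => u v; exact: stack_sym.
apply/and3P; split; apply/forallP => x; rewrite ?inE ?connect0 //.
  by apply/forallP => y; rewrite !inE /= sc implybb.
apply/forallP => y; apply/forallP => z; rewrite !inE /=.
by apply/implyP => /andP[]; exact: connect_trans.
Qed.

Definition partsg_mul xi eta : partsg := Partsg (partsg_mul_equiv xi eta).

(* Associativity: an equivalence relation is determined by the two-colourings
   constant on its classes, and these compose. *)
Definition colouring (f g : 'I_n -> bool) (x : vertex) : bool :=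
  match x with inl k => f k | inr k => g k end.

Definition respects xi (f g : 'I_n -> bool) : Prop :=
  forall x y, related xi x y -> colouring f g x = colouring f g y.

Lemma respects_inj xi eta :
  (forall f g, respects xi f g <-> respects eta f g) -> xi = eta.
Proof.
suff sub a b : (forall f g, respects a f g -> respects b f g) ->
    forall x y, related b x y -> related a x y.
  move=> H; apply/val_inj/setP => -[x y]; apply/idP/idP; apply: sub => f g.
    by move/(H f g).
  by move/(H f g).
move=> H x y bxy.
have colE z : colouring (related a x \o inl) (related a x \o inr) z
    = related a x z by case: z.
have := H (related a x \o inl) (related a x \o inr) _ x y bxy.
rewrite !colE related_refl => <- // u v auv; rewrite !colE.
apply/idP/idP => [axu|axv]; first exact: related_trans axu auv.
exact: related_trans axv (related_sym auv).
Qed.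

Lemma respects_mul xi eta f h :
  respects (partsg_mul xi eta) f h <->
  exists2 g, respects xi f g & respects eta g h.
Proof.
pose C := connect (fun u v => (u, v) \in stack xi eta).
have sc : connect_sym (fun u v => (u, v) \in stack xi eta).
  by apply: sym_connect_sym => u v; exact: stack_sym.
have Cxi x y : related xi x y -> C (emb_top x) (emb_top y).
  move=> xy; apply: connect1; rewrite !inE; apply/orP; left.
  by apply/imsetP; exists (x, y).
have Ceta x y : related eta x y -> C (emb_bot x) (emb_bot y).
  move=> xy; apply: connect1; rewrite !inE; apply/orP; right.
  by apply/imsetP; exists (x, y).
split=> [fh | [g fg gh] x y]; last first.
  rewrite /related inE /=.
  pose c (u : vertex3) := match u with
    | inl x => colouring f g x | inr k => h k end.
  have cout z : c (emb_out z) = colouring f h z by case: z.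
  rewrite -!cout; move: (emb_out x) (emb_out y) => u v.
  case/connectP => p; elim: p u => [|w p IH] u /=; first by move=> _ ->.
  case/andP => uw /IH{}IH /IH <-.
  move: uw; rewrite !inE => /orP[] /imsetP[[a b] ab [-> ->]].
    exact: fg.
  have cbot z : c (emb_bot z) = colouring g h z by case: z.
  by rewrite !cbot; exact: gh.
pose c (u : vertex3) : bool :=
  [exists z, C u (emb_out z) && colouring f h z].
have cC u v : C u v -> c u = c v.
  move=> uv; apply/existsP/existsP => -[z /andP[uz fz]]; exists z;
    rewrite fz andbT; last exact: connect_trans uv uz.
  by apply: connect_trans uz; rewrite [connect _ _ _]sc.
have cout z : c (emb_out z) = colouring f h z.
  apply/existsP/idP => [[w /andP[zw]]|fz]; last first.
    by exists z; rewrite fz andbT; exact: connect0.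
  by rewrite (fh z w) // /related inE.
exists (c \o inl \o inr).
  have ctop z : colouring f (c \o inl \o inr) z = c (emb_top z).
    by case: z => k //; rewrite -[LHS](cout (inl k)).
  by move=> x y xy; rewrite !ctop; exact/cC/Cxi.
have cbot z : colouring (c \o inl \o inr) h z = c (emb_bot z).
  by case: z => k //; rewrite -[LHS](cout (inr k)).
by move=> x y xy; rewrite !cbot; exact/cC/Ceta.
Qed.

Lemma partsg_mulA : associative partsg_mul.
Proof.
move=> xi eta zeta; apply: respects_inj => f g; split.
  move/respects_mul => [h ? /respects_mul[k ? ?]].
  by apply/respects_mul; exists k => //; apply/respects_mul; exists h.
move/respects_mul => [h /respects_mul[k ? ?] ?].
by apply/respects_mul; exists k => //; apply/respects_mul; exists h.
Qed.

HB.instance Definition _ := isSemigroup.Build partsg partsg_mulA.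

Definition blocks xi : {set {set vertex}} :=
  equivalence_partition (related xi) [set: vertex]%SET.

Definition brauer : set partsg :=
  [set xi | forall B, B \in blocks xi -> #|B| = 2].

End PartitionSemigroup.

Section AnnularSemigroup.
Variables (R : realType) (n : nat).

Local Open Scope ring_scope.

(* R[i]^o is the complex field with the topology of its modulus. *)
Definition boundary_point (x : vertex n) : R[i]^o :=
  let e (k : 'I_n) : R[i] :=
    let t : R := 2 * pi * k%:R / n%:R in (cos t +i* sin t)%C in
  match x with inl k => e k | inr k => 2 * e k end.

Definition annulus : set R[i]^o := [set z | 1 < `|z| < 2].

Definition is_string (x y : vertex n) (gamma : R -> R[i]^o) : Prop :=
  [/\ {within `[0, 1], continuous gamma},
      gamma 0 = boundary_point x,
      gamma 1 = boundary_point y &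
      forall t : R, 0 < t < 1 -> annulus (gamma t)].

Definition annular_diagram (xi : partsg n)
    (gamma : {set vertex n} -> R -> R[i]^o) : Prop :=
  forall B, B \in blocks xi ->
    exists x y : vertex n,
      [/\ x != y, B = [set x; y]%SET & is_string x y (gamma B)].

Definition disjoint_strings (xi : partsg n)
    (gamma : {set vertex n} -> R -> R[i]^o) : Prop :=
  forall B B', B \in blocks xi -> B' \in blocks xi -> B != B' ->
    (gamma B @` `[0, 1]) `&` (gamma B' @` `[0, 1]) = set0.

Definition annular : set (partsg n) :=
  [set xi | brauer xi /\
    exists gamma, annular_diagram xi gamma /\ disjoint_strings xi gamma].

End AnnularSemigroup.

Arguments brauer n : clear implicits.
Arguments annular R n : clear implicits.

(* Main.v *)
From Pilot Require Import Defs.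
From HB Require Import structures.
From mathcomp Require Import all_boot all_order all_algebra all_fingroup.
From mathcomp Require Import all_classical all_reals all_analysis.
From mathcomp Require Import complex zify ring lra.
(* [act] is the action on the states of a wreath product, not a group action *)
Import Pilot.Defs.

Set Implicit Arguments.
Unset Strict Implicit.
Unset Printing Implicit Defensive.

Local Open Scope classical_set_scope.

(** Write m = 2n - 1 and let A be the annular semigroup of degree m, inside the
    Brauer semigroup B of the same degree.

    Upper bound. Divisors of products pass to subsemigroups, and A is one of B
    ([annular_mul]), so it is enough to decompose B. The rank of a diagram, the
    number of its strings that join the two circles, is odd ([rank_odd]), hence
    is one of 1, 3, ..., m. A machine reads the factors of a product and keeps
    track of a left ideal B t, with rank t <= r, that contains the running
    product ([tracks]). Multiplying by one more factor either carries one ideal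
    of rank r bijectively onto another, which is the work of a group, or drops
    into an ideal of smaller rank, which is the work of an aperiodic semigroup
    of constant maps. So one group factor and one aperiodic factor replace the
    bound r by r - 2 ([tracksS]), and n - 1 such steps lead from m to 1. In
    rank 1 no group is left, because t x t = t there ([rank1_sandwich]), and an
    aperiodic factor recovers the product itself ([tracks1_divides]).

    Lower bound. Let z be an element of a group with identity i, and let
    e = e i = i e be an idempotent. Lift z and e to a product
    A_k wr (G_k wr (... (G_1 wr A_0))). In A_0 the group of z collapses, so the
    image of e there is a state fixed by the lifts of z and e; at that state
    the G_1-coordinate is a homomorphism to a group, and kills all products of
    conjugates of e by powers of z. Hence such products u that satisfy e u = u
    divide a product with one group fewer ([divides_peel]), while z = i if
    there is no group at all ([divides_aperiodic]). In A take z to be the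
    rotation by one point and e a diagram with one hook on each circle. Then
    e z e is the rotation of the m - 2 points left free, and its m-th power is
    a product of conjugates of e; since m is odd it generates the same group as
    e z e, which is therefore itself such a product
    ([conj_closure_rotation]). So the semigroup generated by z and e contains,
    inside the products of conjugates of e, a copy of its analogue with m - 2
    in place of m, and each of the n - 1 such steps costs one group
    ([level_complexity]).

    Diagrams are computed with through the relation [respects xi] between
    colourings of the inner and of the outer points. It determines xi and turns
    products of diagrams into composites of relations.

    The only topology needed is that A contains the rotation and the hook, for
    which the strings are written down, and that A is closed under products:
    the two diagrams are squeezed into the two halves of the annulus, and the
    strings of the product are concatenations of strings of the factors. *)

(** * Finite and aperiodic wreath products *)

Lemma unit_mulA : associative (fun _ _ : unit => tt).
Proof. by []. Qed.
HB.instance Definition _ := isSemigroup.Build unit unit_mulA.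

Lemma actM (T : semigroupType) (x : option T) t u :
  act x (t * u)%g = act (act x t) u.
Proof. by case: x => [s|] //=; rewrite mulgA. Qed.

Lemma wreath_ext (S T : semigroupType) (p q : wreath S T) :
  p.1 =1 q.1 -> p.2 = q.2 -> p = q.
Proof. by case: p q => [f t] [g u] /= /funext -> ->. Qed.

(** Finiteness in a form that also applies to bare types, such as the states
    [option T]. *)
Definition enumerable (T : Type) :=
  exists (I : finType) (en : I -> T), forall x, exists i, en i = x.

Lemma finite_setE (T : choiceType) : finite_set [set: T] <-> enumerable T.
Proof.
split=> [fT|[I [en enP]]]; last first.
  apply: (@sub_finite_set _ _ (range en)); first by move=> x _; have [i <-] := enP x; exists i.
  exact: finite_image.
pose s := finmap.enum_fset (fset_set [set: T]).
exists (seq_sub s), val => x.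
have xs : x \in s by rewrite [_ \in s]in_fset_set // inE.
by exists (SeqSub xs).
Qed.

Lemma enumerable_prod (S T : Type) : enumerable S -> enumerable T -> enumerable (S * T).
Proof.
move=> [I [e eP]] [J [f fP]]; exists (I * J)%type, (fun p => (e p.1, f p.2)).
by move=> [x y]; have [i <-] := eP x; have [j <-] := fP y; exists (i, j).
Qed.

Lemma enumerable_option T : enumerable T -> enumerable (option T).
Proof.
move=> [I [e eP]]; exists (option I), (omap e).
by move=> [x|]; [have [i <-] := eP x; exists (Some i)|exists None].
Qed.

Lemma enumerable_fun (S T : Type) : enumerable S -> enumerable T -> enumerable (S -> T).
Proof.
move=> [I [e eP]] [J [f fP]].
pose c x := projT1 (cid (eP x)).
have cK x : e (c x) = x by rewrite /c; case: cid.
exists {ffun I -> J}, (fun (g : {ffun I -> J}) x => f (g (c x))) => h.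
have /choice[g gP] x := fP (h (e x)).
by exists (finfun g); apply/funext => x; rewrite ffunE gP cK.
Qed.

Lemma enumerable_fin (T : finType) : enumerable T.
Proof. by exists T, id => x; exists x. Qed.

Lemma enumerable_ffun (I : finType) (T : Type) : enumerable T -> enumerable {ffun I -> T}.
Proof.
move=> [J [f fP]]; exists {ffun I -> J}, (fun g : {ffun I -> J} => [ffun i => f (g i)]) => h.
have /choice[g gP] x := fP (h x).
by exists (finfun g); apply/ffunP => x; rewrite !ffunE.
Qed.

Lemma enumerable_wreath (S T : semigroupType) :
  enumerable S -> enumerable T -> enumerable (wreath S T).
Proof.
move=> S1 T1; apply: enumerable_prod => //; apply: enumerable_fun => //.
exact: enumerable_option.
Qed.

Lemma kr_product_enumerable k W : kr_product k W -> enumerable W.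
Proof.
elim=> {k W} [A /finite_setE //|k A G W /finite_setE fA _ _ fW].
by do 2?apply: enumerable_wreath => //; exact: enumerable_fin.
Qed.

Lemma sub_divides (M : semigroupType) (S P : set M) (T : semigroupType) :
  P `<=` S -> subsemigroup P -> divides S T -> divides P T.
Proof.
move=> PS Pc [U [f [Uc fM fU]]]; exists (U `&` f @^-1` P), f; split.
- move=> x y [Ux Px] [Uy Py]; split; first exact: Uc.
  by rewrite /= fM //; exact: Pc.
- by move=> x y [Ux _] [Uy _]; exact: fM.
apply/seteqP; split=> [_ [x [_ Px] <-] //|p Pp].
have := PS _ Pp; rewrite -fU => -[x Ux xp].
by exists x => //; split => //; rewrite /= xp.
Qed.

Lemma aperiodic_ffun (I : finType) (A : semigroupType) :
  aperiodic A -> aperiodic {ffun I -> A}.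
Proof.
move=> aA H [Hc [e He eP]]; exists e.
apply/seteqP; split=> [h Hh|_ -> //]; apply/ffunP => i.
have [] := aA [set g i | g in H].
  split; first by move=> _ _ [g Hg <-] [g' Hg' <-]; exists (g * g')%g; [exact: Hc|rewrite ffunE].
  exists (e i); first by exists e.
  move=> _ [g Hg <-]; have [eg ge [g' Hg' [gg' g'g]]] := eP _ Hg; split.
  - by rewrite -{2}eg ffunE.
  - by rewrite -{2}ge ffunE.
  - by exists (g' i); [exists g'|split; [rewrite -gg' ffunE|rewrite -g'g ffunE]].
move=> a Ha.
have : [set g i | g in H] (h i) by exists h.
have : [set g i | g in H] (e i) by exists e.
by rewrite Ha /= => -> ->.
Qed.

(** A subgroup H projects to a trivial group {b}, so on the states of the form
    x b it acts by a subgroup of A, which is trivial too. The remaining states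
    do not matter, since h = e h for the identity e of H. *)
Lemma aperiodic_wreath (A B : semigroupType) :
  aperiodic A -> aperiodic B -> aperiodic (wreath A B).
Proof.
move=> aA aB H [Hc [e He eP]]; exists e.
have [] := aB [set g.2 | g in H].
  split; first by move=> _ _ [g Hg <-] [g' Hg' <-]; exists (g * g')%g => //; exact: Hc.
  exists e.2; first by exists e.
  move=> _ [g Hg <-]; have [eg ge [g' Hg' [gg' g'g]]] := eP _ Hg; split.
  - by rewrite -{2}eg.
  - by rewrite -{2}ge.
  - by exists g'.2; [exists g'|split; [rewrite -gg'|rewrite -g'g]].
move=> b Hb.
have H2 g : H g -> g.2 = b.
  by move=> Hg; have : [set g.2 | g in H] g.2 by [exists g]; rewrite Hb.
have bb : (b * b)%g = b by rewrite -{3}(H2 _ (Hc _ _ He He)) /= !H2.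
have H1 x g : H g -> g.1 (act x b) = e.1 (act x b).
  move=> Hg; have [] := aA [set g.1 (act x b) | g in H].
    have pr g1 g2 : H g1 -> (g1 * g2)%g.1 (act x b) = (g1.1 (act x b) * g2.1 (act x b))%g.
      by move=> H_; rewrite /= H2 // -actM bb.
    split.
      move=> _ _ [g1 Hg1 <-] [g' Hg' <-]; exists (g1 * g')%g; last by rewrite pr.
      exact: Hc.
    exists (e.1 (act x b)); first by exists e.
    move=> _ [g1 Hg1 <-]; have [eg ge [g' Hg' [gg' g'g]]] := eP _ Hg1; split.
    - by rewrite -pr // eg.
    - by rewrite -pr // ge.
    - by exists (g'.1 (act x b)); [exists g'|rewrite -!pr // gg' g'g].
  move=> a Ha.
  have : [set g.1 (act x b) | g in H] (g.1 (act x b)) by exists g.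
  have : [set g.1 (act x b) | g in H] (e.1 (act x b)) by exists e.
  by rewrite Ha /= => -> ->.
apply/seteqP; split=> [h Hh|_ -> //].
have [eh _ _] := eP _ Hh; have [ee _ _] := eP _ He.
have -> : h = (e * e)%g by rewrite -eh; apply: wreath_ext => [x|] /=; rewrite ?H2 // !H1.
by rewrite ee.
Qed.

Lemma aperiodic_unit : aperiodic unit.
Proof.
by move=> H [_ [[] H1 _]]; exists tt; apply/seteqP; split=> [[] //|_ ->].
Qed.

(** Semigroups have no power x^0, so [pow x n] is the power with exponent
    n + 1. *)
Fixpoint pow (M : semigroupType) (x : M) (n : nat) : M :=
  if n is n'.+1 then (x * pow x n')%g else x.

Lemma powS (M : semigroupType) (x : M) n : pow x n.+1 = (x * pow x n)%g.
Proof. by []. Qed.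

Lemma powD (M : semigroupType) (x : M) a b :
  (pow x a * pow x b)%g = pow x (a + b).+1.
Proof. by elim: a => [|a IH] //=; rewrite -mulgA IH. Qed.

Lemma powSr (M : semigroupType) (x : M) a : (pow x a * x)%g = pow x a.+1.
Proof. by rewrite -[X in (_ * X)%g]/(pow x 0) powD addn0. Qed.

Lemma powM (M : semigroupType) (x : M) a b :
  pow (pow x a) b = pow x (a.+1 * b.+1).-1.
Proof.
elim: b => [|b IH]; first by rewrite muln1.
rewrite powS IH powD; congr pow; lia.
Qed.

Lemma pow_morph (M N : semigroupType) (U : set M) (f : M -> N) :
  subsemigroup U -> (forall x y, U x -> U y -> f (x * y)%g = (f x * f y)%g) ->
  forall x n, U x -> U (pow x n) /\ f (pow x n) = pow (f x) n.
Proof.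
move=> Uc fM x n Ux; elim: n => [|n [IH1 IH2]] //=; split; first exact: Uc.
by rewrite fM // IH2.
Qed.

Lemma pow_idem (M : semigroupType) (x : M) n : (x * x)%g = x -> pow x n = x.
Proof. by move=> xx; elim: n => [|n IH] //=; rewrite IH. Qed.

(** Two powers of x coincide, so the powers are eventually periodic; an exponent
    that is both large and a multiple of the period gives an idempotent. *)
Lemma idem_pow (M : semigroupType) : enumerable M ->
  forall x : M, exists n, (pow x n * pow x n)%g = pow x n.
Proof.
move=> [I [e eP]] x.
have /choice[c cP] n := eP (pow x n).
have [i [j [ij cij]]] : exists i j : nat, (i < j)%N /\ c i = c j.
  have /injectivePn[i [j nij cij]] : ~~ injectiveb (fun i : 'I_#|I|.+1 => c i).
    apply/negP => /injectiveP /leq_card; rewrite card_ord; lia.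
  case: (ltngtP i j) => ij; [by exists i, j|by exists j, i|].
  by move: nij; rewrite (val_inj ij) eqxx.
have pij : pow x i = pow x j by rewrite -!cP cij.
pose d := (j - i)%N.
have per a k : (i <= a)%N -> pow x (a + k * d) = pow x a.
  move=> ia; elim: k => [|k IH]; first by rewrite addn0.
  rewrite -IH; case: (ltngtP (a + k * d) i) => [|ai|ai]; first lia.
    have -> : (a + k.+1 * d = (j + (a + k * d - i).-1).+1)%N by rewrite /d; nia.
    by rewrite -powD -pij powD; congr pow; lia.
  have -> : (a + k.+1 * d = j)%N by rewrite /d; nia.
  by rewrite ai.
exists (i.+1 * d).-1; rewrite powD.
have -> : ((i.+1 * d).-1 + (i.+1 * d).-1).+1 = ((i.+1 * d).-1 + i.+1 * d)%N.
  by rewrite /d; nia.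
by rewrite per // /d; nia.
Qed.

(** * Peeling the innermost factors off a wreath product *)

(** [z] is a unit of the local monoid with identity [i], with inverse [z'], and
    [e] is an idempotent of that monoid. *)
Record unit_below (M : semigroupType) (z z' i e : M) : Prop := UnitBelow {
  ub_zz' : (z * z' = i)%g; ub_z'z : (z' * z = i)%g;
  ub_iz : (i * z = z)%g; ub_zi : (z * i = z)%g;
  ub_iz' : (i * z' = z')%g; ub_z'i : (z' * i = z')%g;
  ub_ie : (i * e = e)%g; ub_ei : (e * i = e)%g; ub_ee : (e * e = e)%g }.

(** Under [unit_below], the semigroup generated by the conjugates of e by the
    powers of z. *)
Inductive conj_closure (M : semigroupType) (z z' e : M) : M -> Prop :=
| conj_base : conj_closure z z' e e
| conj_conj u : conj_closure z z' e u -> conj_closure z z' e (z * u * z')%g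
| conj_mul u v : conj_closure z z' e u -> conj_closure z z' e v ->
    conj_closure z z' e (u * v)%g.

Section Projection.
Variables (S X : semigroupType).
Implicit Types z i e : wreath S X.

Lemma unit_below_snd z (z' : wreath S X) i e :
  unit_below z z' i e -> unit_below z.2 z'.2 i.2 e.2.
Proof.
move=> [h1 h2 h3 h4 h5 h6 h7 h8 h9].
split; [rewrite -h1|rewrite -h2|rewrite -{2}h3|rewrite -{2}h4|rewrite -{2}h5
  |rewrite -{2}h6|rewrite -{2}h7|rewrite -{2}h8|rewrite -{3}h9]; by [].
Qed.

Lemma conj_closure_snd z (z' : wreath S X) e u :
  conj_closure z z' e u -> conj_closure z.2 z'.2 e.2 u.2.
Proof.
elim=> [|{}u _ IH|{}u v _ IHu _ IHv].
- exact: conj_base.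
- exact: conj_conj IH.
- exact: conj_mul IHu IHv.
Qed.
End Projection.

Lemma aperiodic_unit_trivial (A : semigroupType) (z z' i e : A) :
  aperiodic A -> unit_below z z' i e -> z = i.
Proof.
move=> aA ub.
have ii : (i * i = i)%g by rewrite -{1}(ub_zz' ub) -mulgA (ub_z'i ub) (ub_zz' ub).
have [] := aA [set x | [/\ (i * x = x)%g, (x * i = x)%g & exists y,
   [/\ (i * y = y)%g, (y * i = y)%g, (x * y = i)%g & (y * x = i)%g]]].
  split.
    move=> x y [ix xi [x' [ix' x'i xx' x'x]]] [iy yi [y' [iy' y'i yy' y'y]]].
    split; rewrite ?mulgA ?ix // -?mulgA ?yi //.
    exists (y' * x')%g; split.
    - by rewrite mulgA iy'.
    - by rewrite -mulgA x'i.
    - by rewrite -mulgA (mulgA y) yy' ix' xx'.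
    - by rewrite -mulgA (mulgA x') x'x iy y'y.
  exists i; first by split=> //; exists i.
  move=> x [ix xi [y [iy yi xy yx]]]; split=> //.
  by exists y => //; split=> //; exists x.
move=> a Ha.
have : [set a] i by rewrite -Ha; split=> //; exists i.
have : [set a] z.
  by rewrite -Ha; case: ub => *; split=> //; exists z'.
by move=> /= -> ->.
Qed.

(** A relational morphism on E that determines its argument u up to left
    multiplication by e. Relations are used instead of functions because a
    lift to a wreath product is constrained only at the reachable states. *)
Definition reflecting (X Y : semigroupType) (E : set X) (e : X)
    (R : X -> Y -> Prop) : Prop :=
  [/\ forall u v y y', R u y -> R v y' -> R (u * v)%g (y * y')%g,
      forall u, E u -> exists y, R u y &
      forall u v y, R u y -> R v y -> (e * u)%g = (e * v)%g].

(** A coordinate of an element p of S wr X matters for e p only at the states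
    that begin with e, and e v is determined by any y related to v. So the
    function of p can be transported to the states of Y, provided that it is
    evaluated simultaneously at all starting states; this is why S is replaced
    by a power T of S, with coordinates indexed by I. *)
Lemma reflecting_wreath (S T X Y : semigroupType) (I : Type)
    (en : I -> option X) (pr : T -> I -> S) (E : set X) (e : wreath S X)
    (R : X -> Y -> Prop) :
  (forall x, exists i, en i = x) ->
  (forall s t i, pr (s * t)%g i = (pr s i * pr t i)%g) ->
  (forall f, exists t, forall i, pr t i = f i) ->
  reflecting E e.2 R ->
  exists R' : wreath S X -> wreath T Y -> Prop,
    @reflecting (wreath S X) (wreath T Y) [set p | E p.2] e R'.
Proof.
move=> enP prM prP [RM RE Re].
pose R' (p : wreath S X) (q : wreath T Y) :=
  [/\ R p.2 q.2, forall i, pr (q.1 None) i = p.1 (act (en i) e.2) &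
   forall v y, R v y -> forall i, pr (q.1 (Some y)) i = p.1 (act (en i) (e.2 * v)%g)].
exists R'; split.
- move=> p p' q q' [Rpq pq0 pq1] [Rpq' pq0' pq1']; split=> /=.
  + exact: RM.
  + by move=> i; rewrite prM pq0 (pq1' _ _ Rpq) actM.
  + move=> v y Rvy i; rewrite prM (pq1 _ _ Rvy) (pq1' _ _ (RM _ _ _ _ Rvy Rpq)).
    by rewrite mulgA !actM.
- move=> p /= /RE[y Ry].
  have /choice[q qP] (x : option Y) : exists t : T,
      (x = None -> forall i, pr t i = p.1 (act (en i) e.2)) /\
      (forall v y, x = Some y -> R v y ->
         forall i, pr t i = p.1 (act (en i) (e.2 * v)%g)).
    case: x => [x|]; last first.
      by have [t tP] := prP (fun i => p.1 (act (en i) e.2)); exists t.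
    have [[v Rv]|nR] := pselect (exists v, R v x); last first.
      have [t _] := prP (fun i => p.1 (act (en i) e.2)).
      by exists t; split=> // v _ [<-] Rv; case: nR; exists v.
    have [t tP] := prP (fun i => p.1 (act (en i) (e.2 * v)%g)).
    exists t; split=> // v' _ [<-] Rv' i; rewrite tP.
    by rewrite (Re _ _ _ Rv Rv').
  exists (q, y); split=> //=; first by have [+ _] := qP None; exact.
  by move=> v y' Rv; have [_ +] := qP (Some y'); apply.
- move=> p p' q [Rpq pq0 _] [Rpq' pq0' _]; apply: wreath_ext => [x|] /=; last first.
    exact: Re Rpq Rpq'.
  by have [i <-] := enP x; rewrite -pq0 pq0'.
Qed.

Lemma reflecting_ffun (A X Y : semigroupType) (E : set X) (e : wreath A X)
    (R : X -> Y -> Prop) :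
  enumerable X -> reflecting E e.2 R ->
  exists (I : finType) (R' : wreath A X -> wreath {ffun I -> A} Y -> Prop),
    @reflecting (wreath A X) (wreath {ffun I -> A} Y) [set p | E p.2] e R'.
Proof.
move=> /enumerable_option[I [en enP]] RR; exists I.
apply: (@reflecting_wreath A {ffun I -> A} X Y I en (fun t i => t i) E e R _ _ _ RR) => //.
  by move=> s t i; rewrite ffunE.
by move=> f; exists (finfun f) => i; rewrite ffunE.
Qed.

Lemma reflecting_dffun (G : finGroupType) (X Y : semigroupType) (E : set X)
    (e : wreath G X) (R : X -> Y -> Prop) :
  enumerable X -> reflecting E e.2 R ->
  exists (H : finGroupType) (R' : wreath G X -> wreath H Y -> Prop),
    @reflecting (wreath G X) (wreath H Y) [set p | E p.2] e R'.
Proof.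
move=> /enumerable_option[I [en enP]] RR; exists {dffun forall _ : I, G}.
apply: (@reflecting_wreath G {dffun forall _ : I, G} X Y I en (fun t i => t i) E e R _ _ _ RR) => //.
  by move=> s t i; rewrite ffunE.
by move=> f; exists (finfun f) => i; rewrite ffunE.
Qed.

Lemma sub_reflecting (X Y : semigroupType) (E E' : set X) (e : X)
    (R : X -> Y -> Prop) :
  E' `<=` E -> reflecting E e R -> reflecting E' e R.
Proof. by move=> EE' [RM RE Re]; split=> // u /EE'; exact: RE. Qed.

(** The group of z is trivial in A, so z, e and their products fix the state e of
    A, up to what precedes it. The value at this state is a homomorphism to
    the group G, and it is trivial at every conjugate of e. *)
Lemma reflecting_base (G : finGroupType) (A : semigroupType)
    (z z' i e : wreath G A) :
  aperiodic A -> unit_below z z' i e ->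
  exists R : wreath G A -> unit -> Prop, @reflecting (wreath G A) unit (conj_closure z z' e) e R.
Proof.
move=> aA ub.
have zi := aperiodic_unit_trivial aA (unit_below_snd ub).
have ii : (i * i = i)%g by rewrite -{1}(ub_zz' ub) -mulgA (ub_z'i ub) (ub_zz' ub).
have idem1 (f : wreath G A) y : (f * f)%g = f -> act y f.2 = y -> f.1 y = 1%g.
  move=> ff yf; have : (f * f)%g.1 y = f.1 y by rewrite ff.
  by rewrite /= yf => /(canRL (mulKg _)); rewrite mulVg.
have ee2 : (e.2 * e.2 = e.2)%g by rewrite -{3}(ub_ee ub).
have ei2 : (e.2 * i.2 = e.2)%g by rewrite -{2}(ub_ei ub).
have ie2 : (i.2 * e.2 = e.2)%g by rewrite -{2}(ub_ie ub).
have z'i2 : (z'.2 = i.2)%g.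
  by rewrite -(ub_iz' (unit_below_snd ub)) -{1}zi (ub_zz' (unit_below_snd ub)).
have trivE u : conj_closure z z' e u ->
    u.2 = e.2 /\ forall x, u.1 (act x e.2) = 1%g.
  elim=> [|{}u _ [u2 u1]|{}u v _ [u2 u1] _ [v2 v1]].
  - split=> // x.
    by apply: idem1; [exact: ub_ee ub|rewrite -actM ee2].
  - split=> [|x] /=; first by rewrite zi u2 z'i2 ie2 ei2.
    rewrite zi -!actM ei2 u1 mulg1 u2 ie2 ee2.
    have : (z * z')%g.1 (act x e.2) = i.1 (act x e.2) by rewrite (ub_zz' ub).
    rewrite /= zi -actM ei2 => ->; apply: idem1 => //.
    by rewrite -actM ei2.
  - split=> [|x] /=; first by rewrite u2 v2 ee2.
    by rewrite u1 u2 -actM ee2 v1 mulg1.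
exists (fun u _ => conj_closure z z' e u); split.
- by move=> u v _ _; exact: conj_mul.
- by move=> u Eu; exists tt.
move=> u v _ /trivE[u2 u1] /trivE[v2 v1].
by apply: wreath_ext => [x|] /=; rewrite ?u1 ?v1 ?u2 ?v2.
Qed.

Lemma krS_inv k W : kr_product k.+1 W -> exists (A : semigroupType)
    (G : finGroupType) (V : semigroupType), [/\ enumerable A, aperiodic A,
    kr_product k V & W = wreath A (wreath G V)].
Proof.
move E : k.+1 => k' H; case: H E => // m A G V /finite_setE fA aA kV [->].
by exists A, G, V.
Qed.

Lemma kr0_inv W : kr_product 0 W -> enumerable W /\ aperiodic W.
Proof.
by move E : 0 => k' H; case: H E => // A /finite_setE fA aA _.
Qed.

(** The factors G_1 wr A_0 disappear by [reflecting_base]; all the other factors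
    are replaced by powers of themselves. *)
Lemma kr_product_peel k (W : semigroupType) (z z' i e : W) :
  kr_product k.+1 W -> unit_below z z' i e ->
  exists (Y : semigroupType) (R : W -> Y -> Prop),
    kr_product k Y /\ reflecting (conj_closure z z' e) e R.
Proof.
elim: k W z z' i e => [|k IH] W z z' i e /krS_inv[A [G [V [fA aA kV eW]]]];
  subst W => ub; have fV := kr_product_enumerable kV.
  have [R RR] := reflecting_base (proj2 (kr0_inv kV)) (unit_below_snd ub).
  have [] := @reflecting_ffun A _ _ _ e _ _ RR.
    by apply: enumerable_wreath => //; exact: enumerable_fin.
  move=> I [R' RR']; exists (wreath {ffun I -> A} unit), R'; split.
    apply: kr_product0.
      apply/finite_setE/enumerable_wreath; first exact: enumerable_ffun.
      exact: enumerable_fin.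
    by apply: aperiodic_wreath; [exact: aperiodic_ffun|exact: aperiodic_unit].
  by apply: sub_reflecting RR' => u; exact: conj_closure_snd.
have [Y [R [kY RR]]] := IH _ _ _ _ _ kV (unit_below_snd (unit_below_snd ub)).
have [H [R' RR']] := @reflecting_dffun G _ _ _ e.2 _ fV RR.
have [] := @reflecting_ffun A _ _ _ e _ _ RR'.
  by apply: enumerable_wreath => //; exact: enumerable_fin.
move=> I [R'' RR'']; exists (wreath {ffun I -> A} (wreath H Y)), R''; split.
  apply: kr_productS => //; last exact: aperiodic_ffun.
  exact/finite_setE/enumerable_ffun.
apply: sub_reflecting RR'' => u /conj_closure_snd/conj_closure_snd.
exact.
Qed.

(** Some power j of a preimage of z is an idempotent above i, and j times that
    preimage lies in a group with identity j. The preimage of e is then cut down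
    to an idempotent below j. *)
Lemma lift_unit_below (M W : semigroupType) (U : set W) (f : W -> M)
    (z z' i e : M) r :
  enumerable W -> subsemigroup U ->
  (forall x y, U x -> U y -> f (x * y)%g = (f x * f y)%g) ->
  unit_below z z' i e -> pow z r = i -> (f @` U) z -> (f @` U) e ->
  exists s s' j c, [/\ unit_below s s' j c, [/\ U s, U s' & U c] &
    [/\ f s = z, f s' = z' & f c = e]].
Proof.
move=> fW Uc fM ub zr [s0 Us0 fs0] [e0 Ue0 fe0].
have [n idn] := idem_pow fW s0; pose j := pow s0 n.
have powU x k : U x -> U (pow x k) by move=> Ux; have [] := pow_morph Uc fM k Ux.
have fpow x k : U x -> f (pow x k) = pow (f x) k.
  by move=> Ux; have [] := pow_morph Uc fM k Ux.
have Uj : U j by exact: powU.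
have ii : (i * i = i)%g by rewrite -{1}(ub_zz' ub) -mulgA (ub_z'i ub) (ub_zz' ub).
have fj : f j = i.
  rewrite -[j](pow_idem r) // /j powM fpow // fs0.
  by rewrite mulnC -powM zr pow_idem.
pose c0 := (j * e0 * j)%g.
have Uc0 : U c0 by apply: (Uc) => //; exact: Uc.
have fc0 : f c0 = e.
  rewrite /c0 fM ?fM //; last exact: Uc.
  by rewrite fj fe0 (ub_ie ub) (ub_ei ub).
have [k idk] := idem_pow fW c0; pose c := pow c0 k.
have jc : (j * c = c)%g.
  by rewrite /c; case: (k) => [|l]; rewrite ?powS /c0 !mulgA idn.
have cj : (c * j = c)%g.
  by rewrite /c; case: (k) => [|l]; rewrite -?powSr /c0 -!mulgA idn.
have jj : pow s0 (n + n).+1 = j by rewrite -powD.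
have jx a : (j * pow s0 (n.+1 + a))%g = pow s0 (n.+1 + a).
  have -> : (n.+1 + a = (n + a).+1)%N by lia.
  by rewrite -powD mulgA idn.
have xj a : (pow s0 (n.+1 + a) * j)%g = pow s0 (n.+1 + a).
  have -> : (n.+1 + a = (a + n).+1)%N by lia.
  by rewrite -powD -mulgA idn.
(* exponents n + 2 and 3n + 2 add up to a multiple of n + 1 *)
pose s := pow s0 (n.+1 + 0); pose s' := pow s0 (n.+1 + (n + n)).
have ss' : (s * s' = j)%g.
  rewrite powD -[RHS]idn -/j -!jj powD; congr pow; lia.
have s's : (s' * s = j)%g.
  rewrite powD -[RHS]idn -/j -!jj powD; congr pow; lia.
have Us : U s by exact: powU.
have Us' : U s' by exact: powU.
have fs : f s = z.
  by rewrite /s addn0 powS fM // fs0 fj (ub_zi ub).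
have Ucc : U c by exact: powU.
exists s, s', j, c; split=> //.
  by split=> //; rewrite /s' /s ?jx ?xj //.
split=> //; last by rewrite fpow // fc0 pow_idem // (ub_ee ub).
have : f (j * s')%g = f s' by rewrite jx.
rewrite fM // fj -(ub_z'z ub) -mulgA -[X in (_ * (X * _))%g]fs -fM //.
by rewrite ss' fj (ub_z'i ub).
Qed.

(** For p with e p = p, knowing a lift of p up to left multiplication by a lift
    of e is knowing p. *)
Lemma divides_peel (M : semigroupType) (S P : set M) (z z' i e : M) r k W :
  unit_below z z' i e -> pow z r = i -> S z -> S e ->
  subsemigroup P -> P `<=` conj_closure z z' e ->
  (forall p, P p -> (e * p)%g = p) ->
  kr_product k.+1 W -> divides S W ->
  divides_kr_product P k.
Proof.
move=> ub zr Sz Se Pc Pz eP kW [U [f [Uc fM fS]]].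
have fW := kr_product_enumerable kW.
have [] := lift_unit_below fW Uc fM ub zr; rewrite ?fS //.
move=> s [s' [j [c [ub' [Us Us' Uc'] [fs fs' fc]]]]].
have [Y [R [kY [RM RE Re]]]] := kr_product_peel kW ub'.
exists Y => //.
have lift p : conj_closure z z' e p -> exists u, [/\ conj_closure s s' c u, U u & f u = p].
  elim=> [|{}p _ [u [cu Uu <-]]|{}p q _ [u [cu Uu <-]] _ [v [cv Uv <-]]].
  - by exists c; split=> //; exact: conj_base.
  - exists (s * u * s')%g; split; first exact: conj_conj.
      by apply: (Uc) => //; exact: Uc.
    by rewrite !fM ?fs ?fs' //; exact: Uc.
  - exists (u * v)%g; split; [exact: conj_mul|exact: Uc|exact: fM].
pose V : set Y := [set y | exists u, [/\ R u y, U u & P (f u)]].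
have /choice[g gP] (y : Y) : exists p : M, forall u, R u y -> U u -> P (f u) -> f u = p.
  have [[u [Ru Uu Pu]]|nV] := pselect (V y); last first.
    by exists z => u *; case: nV; exists u.
  exists (f u) => v Rv Uv Pv.
  by rewrite -(eP _ Pu) -(eP _ Pv) -fc -!fM // (Re _ _ _ Ru Rv).
exists V, g; split.
- move=> y y' [u [Ru Uu Pu]] [v [Rv Uv Pv]]; exists (u * v)%g.
  by split; [exact: RM|exact: Uc|rewrite fM //; exact: Pc].
- move=> y y' [u [Ru Uu Pu]] [v [Rv Uv Pv]].
  rewrite -(gP _ _ Ru Uu Pu) -(gP _ _ Rv Uv Pv) -fM //.
  by symmetry; apply: gP; [exact: RM|exact: Uc|rewrite fM //; exact: Pc].
apply/seteqP; split=> [_ [y [u [Ru Uu Pu]] <-]|p Pp].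
  by rewrite -(gP _ _ Ru Uu Pu).
have [u [cu Uu fu]] := lift _ (Pz _ Pp).
have [y Ry] := RE _ cu; have Pu : P (f u) by rewrite fu.
by exists y; [exists u|rewrite -(gP _ _ Ry Uu Pu)].
Qed.

Lemma divides_aperiodic (M : semigroupType) (S : set M) (z z' i e : M) r W :
  unit_below z z' i e -> pow z r = i -> S z -> S e ->
  kr_product 0 W -> divides S W -> z = i.
Proof.
move=> ub zr Sz Se /kr0_inv[fW aW] [U [f [Uc fM fS]]].
have [] := lift_unit_below fW Uc fM ub zr; rewrite ?fS //.
move=> s [s' [j [c [ub' [Us Us' Uc'] [fs fs' fc]]]]].
have sj := aperiodic_unit_trivial aW ub'.
by rewrite -(ub_zz' ub) -fs' -fs -fM // (ub_zz' ub') sj.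
Qed.

(** * Products of Brauer diagrams *)

Lemma involution_even (T : finType) (s : T -> T) (A : {set T}) :
  involutive s -> (forall x, s x != x) -> (forall x, x \in A -> s x \in A) ->
  ~~ odd #|A|.
Proof.
move=> sK sN; elim: {A}_.+1 {-2}A (ltnSn #|A|) => // k IH A Ak sA.
have [->|[x xA]] := set_0Vmem A; first by rewrite cards0.
have sxA : s x \in (A :\ x)%SET by rewrite !inE sN sA.
rewrite (cardsD1 x) xA (cardsD1 (s x)) sxA /= negbK.
apply: IH => [|y].
  by move: Ak; rewrite (cardsD1 x) xA (cardsD1 (s x)) sxA; lia.
rewrite !inE => /and3P[ysx yx yA]; rewrite sA // andbT.
by rewrite (can_eq sK) yx; apply: contra ysx => /eqP <-; rewrite sK.
Qed.

Section Brauer.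
Variable n : nat.
Implicit Types (xi eta : partsg n) (x y z : vertex n).

Lemma blocksP xi (B : {set vertex n}) :
  reflect (exists x, B = [set y | related xi x y]%SET) (B \in blocks xi).
Proof.
by apply: (iffP imsetP) => [[x _ ->]|[x ->]]; exists x => //;
  apply/setP => y; rewrite !inE.
Qed.

Lemma brauer_card xi :
  brauer n xi <-> forall x, #|[set y | related xi x y]%SET| = 2.
Proof.
split=> [bxi x|H _ /blocksP[x ->] //].
by apply/bxi/blocksP; exists x.
Qed.

Definition partner xi x := odflt x [pick y | related xi x y && (y != x)].

Lemma partner_related xi x : related xi x (partner xi x).
Proof.
by rewrite /partner; case: pickP => [y /andP[]//|_]; exact: related_refl.
Qed.

Section OneDiagram.
Variable xi : partsg n.
Hypothesis bxi : brauer n xi.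

Lemma partner_neq x : partner xi x != x.
Proof.
rewrite /partner; case: pickP => [y /andP[]//|/= H].
have := (brauer_card xi).1 bxi x.
suff -> : [set y | related xi x y]%SET = [set x]%SET by rewrite cards1.
apply/setP => y; rewrite !inE; apply/idP/eqP => [xy|->]; last exact: related_refl.
by have := H y; rewrite xy => /negbFE/eqP.
Qed.

Lemma relatedE x y : related xi x y = (y == x) || (y == partner xi x).
Proof.
have := (brauer_card xi).1 bxi x; set A := [set _ | _]%SET => cA.
have AE : [set x; partner xi x]%SET = A.
  apply/eqP; rewrite eqEcard cA cards2 eq_sym partner_neq andbT.
  apply/fintype.subsetP => z; rewrite !inE => /orP[]/eqP->; first exact: related_refl.
  exact: partner_related.
have <- : (y \in A) = related xi x y by rewrite inE.
by rewrite -AE !inE.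
Qed.

Lemma partnerK : involutive (partner xi).
Proof.
move=> x; have := related_sym (partner_related xi x).
by rewrite relatedE => /orP[]/eqP // h; have := partner_neq x; rewrite -h eqxx.
Qed.

Lemma partner_inj : injective (partner xi).
Proof. exact: inv_inj partnerK. Qed.

Lemma respects_partner f g : respects xi f g <->
  forall x, colouring f g (partner xi x) = colouring f g x.
Proof.
split=> [H x|H x y]; first by symmetry; exact/H/partner_related.
by rewrite relatedE => /orP[]/eqP -> //; rewrite H.
Qed.

Definition parity (f : 'I_n -> bool) := odd #|[set k | f k]%SET|.

Lemma card_colouring (f g : 'I_n -> bool) :
  #|[set x | colouring f g x]%SET| = #|[set k | f k]%SET| + #|[set k | g k]%SET|.
Proof.
rewrite -!sum1_card (eq_bigl (colouring f g)); last by move=> x; rewrite inE.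
rewrite big_sumType /=; congr addn; apply: eq_bigl => k; by rewrite inE.
Qed.

(** Both circles together contain an even number of true points, since true
    points come in blocks of two. *)
Lemma respects_parity f g : respects xi f g -> parity f = parity g.
Proof.
move/respects_partner => H; apply/eqP; rewrite -negb_add -oddD -card_colouring.
by apply: involution_even partnerK partner_neq _ => x; rewrite !inE H.
Qed.
End OneDiagram.

Lemma colouring_related xi x : respects xi (related xi x \o inl) (related xi x \o inr).
Proof.
have colE z : colouring (related xi x \o inl) (related xi x \o inr) z
    = related xi x z by case: z.
move=> u v uv; rewrite !colE; apply/idP/idP => h; first exact: related_trans h uv.
exact: related_trans h (related_sym uv).
Qed.

Section Product.
Variables xi eta : partsg n.
Hypotheses (bxi : brauer n xi) (beta : brauer n eta).

Local Notation adj := (fun u v => (u, v) \in stack xi eta).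

(** The neighbours of a vertex of the stacked diagrams: a vertex of the middle
    circle has two, and a vertex of the inner or outer circle has itself and
    one more. *)
Definition nbr_xi (u : vertex3 n) : vertex3 n :=
  if u is inl x then inl (partner xi x) else u.
Definition nbr_eta (u : vertex3 n) : vertex3 n :=
  match u with
  | inl (inl _) => u
  | inl (inr k) => emb_bot (partner eta (inl k))
  | inr k => emb_bot (partner eta (inr k))
  end.

Lemma adjE u v : adj u v -> [\/ v = u, v = nbr_xi u | v = nbr_eta u].
Proof.
have nE z : nbr_eta (emb_bot z) = emb_bot (partner eta z) by case: z.
rewrite !inE => /orP[]/imsetP[[x y] /= xy [-> ->]].
  move: xy; rewrite -[_ \in _]/(related xi x y) relatedE //.
  by case/orP => /eqP ->; [apply: Or31|apply: Or32].
move: xy; rewrite -[_ \in _]/(related eta x y) relatedE // nE.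
by case/orP => /eqP ->; [apply: Or31|apply: Or33].
Qed.

Lemma outer_nbr x : nbr_xi (emb_out x) = emb_out x \/ nbr_eta (emb_out x) = emb_out x.
Proof. by case: x => k; [right|left]. Qed.

Lemma emb_out_inj : injective (@emb_out n).
Proof. by move=> [k|k] [l|l] //= [->]. Qed.

Lemma not_outer (u : vertex3 n) : (forall x, u <> emb_out x) -> exists k, u = inl (inr k).
Proof.
case: u => [[k|k]|k] H; [by case: (H (inl k))|by exists k|by case: (H (inr k))].
Qed.

(** All vertices of the path have used up their two neighbours (one, for the two
    ends), so the path is a whole connected component; and its inner vertices,
    having two neighbours, lie on the middle circle. *)
Lemma uniq_path_ends x y p : x != y -> path adj (emb_out x) p ->
  uniq (emb_out x :: p) -> last (emb_out x) p = emb_out y ->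
  (forall z, connect adj (emb_out x) (emb_out z) -> z = x \/ z = y) /\
  (forall i, (i < (size p).-1)%N -> exists k, nth (emb_out x) p i = inl (inr k)).
Proof.
move=> xy /(pathP (emb_out x)) ap up lp; set ex := emb_out x in ap up lp *.
set s := ex :: p; pose v i := nth ex s i.
have pN : (0 < size p)%N.
  by case: (p) lp => //= /emb_out_inj h; rewrite h eqxx in xy.
have vinj i j : (i <= size p)%N -> (j <= size p)%N -> v i = v j -> i = j.
  by move=> ip jp /eqP; rewrite nth_uniq // => /eqP.
have vadj i : (i < size p)%N -> adj (v i) (v i.+1) by exact: ap.
have vadj' i : (i < size p)%N -> adj (v i.+1) (v i).
  by move=> ip; rewrite -stack_sym; exact: vadj.
have v0 : v 0 = ex by [].
have vN : v (size p) = emb_out y by rewrite -lp (last_nth ex).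
have inner i : (0 < i < size p)%N -> exists k, v i = inl (inr k).
  move=> /andP[i0 ip]; apply: not_outer => z vz.
  have a1 := adjE (vadj _ ip); have ip' : (i.-1 < size p)%N by lia.
  have a2 := adjE (vadj' _ ip'); rewrite prednK // in a2.
  have n1 : v i.+1 <> v i by move/vinj => h; lia.
  have n2 : v i.-1 <> v i by move/vinj => h; lia.
  have n3 : v i.-1 <> v i.+1 by move/vinj => h; lia.
  by case: a1 => // h1; case: a2 => // h2; case: (outer_nbr z) => h3;
    move: h1 h2 n1 n2 n3; rewrite !vz ?h3 => -> -> *; congruence.
split; last first.
  by move=> i ip; have [|k vk] := inner i.+1; [lia|exists k].
have closedv i w : (i <= size p)%N -> adj (v i) w -> exists2 j, (j <= size p)%N & w = v j.
  move=> ip /adjE vw.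
  have [i0|i0] := posnP i.
    have n1 : v 1 <> v i by rewrite i0 => /vinj h; lia.
    have a1 := adjE (vadj _ pN); rewrite -i0 in a1.
    have [->|->] : w = v i \/ w = v 1; [|by exists i|by exists 1].
    move: (outer_nbr x); rewrite -/ex -v0 -i0.
    by move: a1 vw n1 => [] a1 [] vw n1 [] h3; (left; congruence) || (right; congruence).
  have [iN|iN] := eqVneq i (size p).
    have n1 : v i.-1 <> v i by move/vinj => h; lia.
    have ip' : (i.-1 < size p)%N by lia.
    have a1 := adjE (vadj' _ ip'); rewrite prednK // in a1.
    have [->|->] : w = v i \/ w = v i.-1; [|by exists i|by exists i.-1; [lia|]].
    move: (outer_nbr y); rewrite -vN -iN.
    by move: a1 vw n1 => [] a1 [] vw n1 [] h3; (left; congruence) || (right; congruence).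
  have ip1 : (i < size p)%N by lia.
  have a1 := adjE (vadj _ ip1); have ip' : (i.-1 < size p)%N by lia.
  have a2 := adjE (vadj' _ ip'); rewrite prednK // in a2.
  have n1 : v i.+1 <> v i by move/vinj => h; lia.
  have n2 : v i.-1 <> v i by move/vinj => h; lia.
  have n3 : v i.-1 <> v i.+1 by move/vinj => h; lia.
  case: vw => [->|->|->]; first by exists i.
    case: a1 => // h1; first by exists i.+1.
    by case: a2 => // h2; [exists i.-1; [lia|]|congruence].
  case: a1 => // h1; last by exists i.+1.
  by case: a2 => // h2; [congruence|exists i.-1; [lia|]].
move=> z /connectP[q qp qz].
suff [j jp zj] : exists2 j, (j <= size p)%N & emb_out z = v j.
  have [j0|j0] := posnP j; first by left; apply: emb_out_inj; rewrite zj j0.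
  have [jN|jN] := eqVneq j (size p); first by right; apply: emb_out_inj; rewrite zj jN.
  by have [|k] := inner j; [lia|rewrite -zj; case: (z)].
rewrite qz; have : exists2 j, (j <= size p)%N & ex = v j by exists 0.
elim: q (ex) qp {qz} => [|w q IH] u //= /andP[uw wq] [j jp uj].
by apply: IH => //; rewrite uj in uw; exact: closedv uw.
Qed.

(** The indicator function of the block of x is a colouring compatible with both
    factors, so by parity the block has a second element y. A path without
    repetitions from x to y then shows that there is no third one. *)
Lemma product_block x : exists y p, [/\ x != y,
  [set z | related (xi * eta)%g x z]%SET = [set x; y]%SET,
  path adj (emb_out x) p /\ last (emb_out x) p = emb_out y,
  forall i, (i < (size p).-1)%N -> exists k, nth (emb_out x) p i = inl (inr k) &
  uniq (emb_out x :: p)].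
Proof.
have rE z : related (xi * eta)%g x z = connect adj (emb_out x) (emb_out z).
  by rewrite /related inE.
have [y xy nyx] : exists2 y, related (xi * eta)%g x y & x != y.
  pose f := related (xi * eta)%g x \o inl; pose h := related (xi * eta)%g x \o inr.
  have /respects_mul[g fg gh] : respects (xi * eta)%g f h by exact: colouring_related.
  have := respects_parity bxi fg; rewrite (respects_parity beta gh) => /eqP.
  rewrite -negb_add -oddD -card_colouring => ev.
  apply: contrapT => H; move: ev.
  suff -> : [set z | colouring f h z]%SET = [set x]%SET by rewrite cards1.
  apply/setP => z; rewrite !inE.
  have -> : colouring f h z = related (xi * eta)%g x z by case: z.
  apply/idP/eqP => [xz|->]; last exact: related_refl.
  by apply/eqP; apply/negPn/negP => zx; apply: H; exists z => //; rewrite eq_sym.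
move: (xy); rewrite rE => /connectP[q /shortenP[p pp up _] lp].
have [H1 H2] := uniq_path_ends nyx pp up (esym lp).
exists y, p; split=> //; apply/setP => z; rewrite !inE.
apply/idP/orP => [|[]/eqP -> //]; last exact: related_refl.
by rewrite rE => /H1[]->; rewrite eqxx; [left|right].
Qed.

Lemma brauer_mul : brauer n (xi * eta)%g.
Proof.
apply/brauer_card => x; have [y [p [xy -> _ _ _]]] := product_block x.
by rewrite cards2 xy.
Qed.
End Product.
End Brauer.

(** * Rank and stability in the Brauer semigroup *)

Section Kernel.
Variables (n : nat) (T : eqType) (lab : vertex n -> T).

Lemma kernel_equivb : equivb [set p : vertex n * vertex n | lab p.1 == lab p.2]%SET.
Proof.
apply/and3P; split; apply/forallP => x; first by rewrite inE.
  by apply/forallP => y; rewrite !inE /= eq_sym implybb.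
apply/forallP => y; apply/forallP => z; rewrite !inE /=.
by apply/implyP => /andP[/eqP -> ].
Qed.

Definition kernel : partsg n := Partsg kernel_equivb.

Lemma related_kernel x y : related kernel x y = (lab x == lab y).
Proof. by rewrite /related inE. Qed.

Lemma respects_kernel f g : respects kernel f g <->
  forall x y, lab x = lab y -> colouring f g x = colouring f g y.
Proof.
by split=> H x y; rewrite ?related_kernel => xy; apply: H; rewrite ?related_kernel;
   apply/eqP.
Qed.
End Kernel.

Section BrauerRank.
Variable n : nat.
Implicit Types (s t : partsg n) (x y z : vertex n) (f g h : 'I_n -> bool).

Definition is_top x := if x is inl _ then true else false.
Definition bar x : vertex n := match x with inl k => inr k | inr k => inl k end.

Lemma barK : involutive bar. Proof. by case. Qed.

Definition idx x : 'I_n := match x with inl k => k | inr k => k end.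

Definition one : partsg n := kernel idx.

Lemma respects_one f g : respects one f g <-> f = g.
Proof.
split=> [/respects_kernel H|<-]; last by apply/respects_kernel => -[k|k] [l|l] /= ->.
by apply/funext => k; exact: (H (inl k) (inr k)).
Qed.

Lemma brauer_one : brauer n one.
Proof.
apply/brauer_card => x; suff -> : [set y | related one x y]%SET = [set x; bar x]%SET.
  by rewrite cards2; case: x.
by apply/setP => y; rewrite !inE related_kernel eq_sym; case: x y => k [l|l]; rewrite /= ?orbF.
Qed.

Lemma mul_one t : (t * one)%g = t.
Proof.
apply: respects_inj => f g; split=> [/respects_mul[h fh /respects_one <-]//|fg].
by apply/respects_mul; exists g => //; exact/respects_one.
Qed.

Lemma one_mul t : (one * t)%g = t.
Proof.
apply: respects_inj => f g; split=> [/respects_mul[h /respects_one <-]//|fg].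
by apply/respects_mul; exists f => //; exact/respects_one.
Qed.

Lemma star_equivb t : equivb [set p : vertex n * vertex n | related t (bar p.1) (bar p.2)]%SET.
Proof.
apply/and3P; split; apply/forallP => x; first by rewrite inE /= related_refl.
  by apply/forallP => y; rewrite !inE /=; apply/implyP; exact: related_sym.
apply/forallP => y; apply/forallP => z; rewrite !inE /=.
by apply/implyP => /andP[]; exact: related_trans.
Qed.

Definition star t : partsg n := Partsg (star_equivb t).

Lemma related_star t x y : related (star t) x y = related t (bar x) (bar y).
Proof. by rewrite /related inE. Qed.

Lemma colouring_bar f g x : colouring f g (bar x) = colouring g f x.
Proof. by case: x. Qed.

Lemma respects_star t f g : respects (star t) f g <-> respects t g f.
Proof.
split=> H x y; last by rewrite related_star => /H; rewrite !colouring_bar.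
by move=> xy; rewrite -!(colouring_bar f g); apply: H; rewrite related_star !barK.
Qed.

Lemma starK t : star (star t) = t.
Proof. by apply: respects_inj => f g; rewrite !respects_star. Qed.

Lemma starM s t : star (s * t)%g = (star t * star s)%g.
Proof.
apply: respects_inj => f g; rewrite respects_star !respects_mul.
by split=> -[h h1 h2]; exists h; rewrite ?respects_star // -respects_star.
Qed.

Lemma brauer_star t : brauer n t -> brauer n (star t).
Proof.
move=> /brauer_card bt; apply/brauer_card => x; rewrite -(bt (bar x)).
rewrite -(card_imset _ (inv_inj barK)); congr #|pred_of_set _|.
apply/setP => y; rewrite !inE; apply/imsetP/idP => [[z + ->]|xy].
  by rewrite inE related_star.
by exists (bar y); rewrite ?barK // inE related_star barK.
Qed.

Lemma partner_star t x : brauer n t -> partner (star t) x = bar (partner t (bar x)).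
Proof.
move=> bt; have := partner_related (star t) x; rewrite related_star relatedE //.
case/orP => /eqP h; last by rewrite -h barK.
by have := partner_neq (brauer_star bt) x; rewrite (inv_inj barK h) eqxx.
Qed.

Definition through t : {set vertex n} := [set x | is_top x && ~~ is_top (partner t x)]%SET.
Definition rank t := #|through t|.

Lemma rank_star t : brauer n t -> rank (star t) = rank t.
Proof.
move=> bt; rewrite /rank -(card_imset (through (star t)) (f := bar \o partner (star t))).
  congr #|pred_of_set _|; apply/setP => y; apply/imsetP/idP => [[x]|].
    rewrite !inE partner_star // => /andP[] + + -> /=; rewrite partner_star // !barK partnerK //.
    by case: x => //= k _; case: (partner _ _).
  rewrite inE => /andP[yT yB]; exists (bar (partner t y)).
    by rewrite inE partner_star // barK partnerK //; case: (partner t y) yB; case: y yT.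
  by rewrite /= partner_star // !barK partnerK.
by apply: inj_comp; [exact: inv_inj barK|exact/partner_inj/brauer_star].
Qed.

Lemma rank_odd t : brauer n t -> odd (rank t) = odd n.
Proof.
move=> bt; pose A := [set x | is_top x && is_top (partner t x)]%SET.
have evA : ~~ odd #|A|.
  apply: (@involution_even _ (partner t)); [exact: partnerK|exact: partner_neq|].
  by move=> x; rewrite !inE partnerK // andbC.
suff <- : rank t + #|A| = n by rewrite oddD (negbTE evA) addbF.
have topE : #|([set inl k | k : 'I_n]%SET : {set vertex n})| = n.
  by rewrite card_imset ?card_ord //; exact: inl_inj.
rewrite /rank -[RHS]topE addnC.
rewrite -(cardsID [set x | is_top (partner t x)]%SET [set inl k | k : 'I_n]%SET).
congr addn; congr #|pred_of_set _|; apply/setP => -[k|k]; rewrite !inE /=.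
- by rewrite imset_f.
- by apply/esym/negP => /andP[/imsetP[]].
- by rewrite imset_f // andbT.
- by apply/esym/negP => /andP[_ /imsetP[]].
Qed.

Lemma rank_le t : (rank t <= n)%N.
Proof.
have topE : #|([set inl k | k : 'I_n]%SET : {set vertex n})| = n.
  by rewrite card_imset ?card_ord //; exact: inl_inj.
rewrite /rank -[leqRHS]topE subset_leq_card //.
by apply/fintype.subsetP => -[k|k]; rewrite inE //= imset_f.
Qed.

Section Stability.
Variables s t : partsg n.
Hypotheses (bs : brauer n s) (bt : brauer n t).
Let bts : brauer n (t * s)%g := brauer_mul bt bs.

Lemma partner_mul_top k l : partner t (inl k) = inl l -> partner (t * s)%g (inl k) = inl l.
Proof.
move=> tkl; have : related (t * s)%g (inl k) (inl l).
  rewrite /related inE /=; apply: connect1; rewrite inE; apply/orP; left.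
  apply/imsetP; exists (inl k, inl l) => //=; rewrite -[_ \in _]/(related t _ _).
  by rewrite -tkl partner_related.
rewrite relatedE // => /orP[]/eqP // h.
by have := partner_neq bt (inl k); rewrite tkl h eqxx.
Qed.

Lemma through_mul : through (t * s)%g \subset through t.
Proof.
apply/fintype.subsetP => -[k|k]; rewrite !inE //=.
by case E: (partner t (inl k)) => [l|//]; rewrite (partner_mul_top E).
Qed.

Lemma rank_mull : (rank (t * s)%g <= rank t)%N.
Proof. exact/subset_leq_card/through_mul. Qed.

(** If no through string of t is lost in t s, then t s and t have the same hooks
    on the inner circle, so (t s) (t s)^* and t t^* are the same projection,
    and t t^* t = t. *)
Lemma stable_mulr : rank (t * s)%g = rank t ->
  exists2 s', brauer n s' & (t * s * s')%g = t.
Proof.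
move=> rE; have E : through (t * s)%g = through t.
  by apply/eqP; rewrite eqEcard through_mul [_ <= _]eq_leq.
have memE k : is_top (partner (t * s)%g (inl k)) = is_top (partner t (inl k)).
  by have /setP/(_ (inl k)) := E; rewrite !inE /= => /negb_inj.
exists (star (t * s) * t)%g; first exact/brauer_mul/bt/brauer_star.
apply: respects_inj => f g; rewrite mulgA; split.
  case/respects_mul => f' /respects_mul[h fh /respects_star f'h] f'g.
  apply/(respects_partner bt).
  move/(respects_partner bts) in fh; move/(respects_partner bts) in f'h.
  move/(respects_partner bt) in f'g.
  have fE k : ~~ is_top (partner t (inl k)) -> f k = f' k.
    rewrite -memE; move: (fh (inl k)) (f'h (inl k)) => /=.
    by case: (partner _ _) => // l /= -> ->.
  case=> k.
    case P: (partner t (inl k)) => [l|l] /=.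
      have := fh (inl k); rewrite (partner_mul_top P) /=; exact.
    by have := f'g (inl k); rewrite P /= => ->; rewrite fE // P.
  case P: (partner t (inr k)) => [l|l] /=; have := f'g (inr k); rewrite P //= => <-.
  by apply: fE; rewrite -P partnerK.
move=> fg; apply/respects_mul; exists f => //; apply/respects_mul.
pose h l := if partner (t * s)%g (inr l) is inl k then f k else false.
suff fh : respects (t * s)%g f h by exists h => //; exact/respects_star.
move/(respects_partner bt) in fg.
apply/(respects_partner bts) => -[k|k].
  case P: (partner (t * s)%g (inl k)) => [l|l] /=.
    have := memE k; rewrite P; case Q: (partner t (inl k)) => [l'|//] _.
    have := partner_mul_top Q; rewrite P => -[->].
    by have := fg (inl k); rewrite Q.
  by rewrite /h -P partnerK.
case P: (partner (t * s)%g (inr k)) => [l|l] /=; first by rewrite /h P.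
by rewrite /h P -P partnerK.
Qed.
End Stability.

Lemma stable_mull s t : brauer n s -> brauer n t -> rank (s * t)%g = rank t ->
  exists2 s', brauer n s' & (s' * (s * t))%g = t.
Proof.
move=> bs bt rE.
have [|s' bs' h] := stable_mulr (brauer_star bs) (brauer_star bt).
  by rewrite -starM !rank_star //; exact: brauer_mul.
exists (star s'); first exact: brauer_star.
by rewrite -{2}(starK t) -h -starM starM starK.
Qed.

Section RankOne.
Variable t : partsg n.
Hypotheses (bt : brauer n t) (t1 : rank t = 1).

(** The hooks on the inner circle pair off all points but k. *)
Lemma parity_rank1 s f k : brauer n s -> rank s = 1 -> ~~ is_top (partner s (inl k)) ->
  (exists g, respects s f g) -> parity f = f k.
Proof.
move=> bs s1 kB [g /(respects_partner bs) fg]; rewrite /parity (cardsD1 k) oddD inE.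
rewrite oddb -[RHS]addbF; congr addb; apply/negbTE.
rewrite -(card_imset _ (@inl_inj 'I_n 'I_n)).
apply: (@involution_even _ (partner s)); [exact: partnerK|exact: partner_neq|].
move=> _ /imsetP[l + ->]; rewrite !inE => /andP[lk fl].
have ks : through s = [set inl k]%SET.
  by move/eqP/cards1P: s1 => [y yE]; move/setP: (yE) => /(_ (inl k)); rewrite !inE kB yE => /esym/eqP ->.
case P: (partner s (inl l)) => [l'|l'].
  apply: imset_f; rewrite !inE; have := fg (inl l); rewrite P /= fl => ->.
  rewrite andbT; apply/eqP => l'k; move: kB; rewrite -l'k -P partnerK //.
have : inl l \in through s by rewrite inE P.
by rewrite ks inE => /eqP[h]; rewrite h eqxx in lk.
Qed.

(** The single through string carries the parity of the colouring. *)
Lemma respects_rank1 f g : respects t f g <->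
  [/\ exists g', respects t f g', exists f', respects t f' g & parity f = parity g].
Proof.
split=> [fg|[[g' fg'] [f' f'g] pfg]].
  by split; [exists g|exists f|exact: respects_parity fg].
have thr k l : partner t (inl k) = inr l -> f k = g l.
  move=> P; rewrite -(@parity_rank1 t f k) ?P //; last by exists g'.
  rewrite pfg; apply: (@parity_rank1 (star t)); first exact: brauer_star.
  - by rewrite rank_star.
  - by rewrite partner_star //= -P partnerK.
  - by exists f'; exact/respects_star.
move/(respects_partner bt) in fg'; move/(respects_partner bt) in f'g.
apply/(respects_partner bt) => -[k|k].
  case P: (partner t (inl k)) => [l|l] /=; first by have := fg' (inl k); rewrite P.
  by rewrite (thr _ _ P).
case P: (partner t (inr k)) => [l|l] /=; last by have := f'g (inr k); rewrite P.
by apply: thr; rewrite -P partnerK.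
Qed.

(** Every diagram preserves the parity of colourings, and t only sees the
    parity. As n is odd, constant colourings realise both parities. *)
Lemma rank1_sandwich s : brauer n s -> (t * s * t)%g = t.
Proof.
move=> bs; apply: respects_inj => f g; split.
  case/respects_mul => h' /respects_mul[h fh hh'] h'g; apply/respects_rank1.
  split; [by exists h|by exists h'|].
  by rewrite (respects_parity bt fh) (respects_parity bs hh') (respects_parity bt h'g).
move=> /respects_rank1[fg gf pfg].
have pc : parity (fun _ : 'I_n => parity f) = parity f.
  rewrite {1}/parity; case: (parity f); last first.
    by rewrite (_ : finset _ = finset.set0) ?cards0 //; apply/setP => k; rewrite !inE.
  rewrite (_ : finset _ = [set: 'I_n]%SET); last by apply/setP => k; rewrite !inE.
  by rewrite cardsT card_ord -(rank_odd bt) t1.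
have cc u : respects u (fun=> parity f) (fun=> parity f) by move=> [k|k] [l|l].
apply/respects_mul; exists (fun=> parity f); last first.
  by apply/respects_rank1; split => //; [exists (fun=> parity f)|rewrite pc].
apply/respects_mul; exists (fun=> parity f) => //.
by apply/respects_rank1; split => //; exists (fun=> parity f).
Qed.
End RankOne.
End BrauerRank.

(** * Tracking the running product: the upper bound *)

(** The constant maps of L together with the identity [None]: composed from left
    to right, the last constant wins. *)
Definition reset (L : Type) : Type := option L.
Section ResetBand.
Variable L : choiceType.
HB.instance Definition _ := Choice.on (reset L).
Definition reset_mul (a b : reset L) : reset L := if b is Some _ then b else a.
Lemma reset_mulA : associative reset_mul.
Proof. by move=> a b [c|]. Qed.
HB.instance Definition _ := isSemigroup.Build (reset L) reset_mulA.

Lemma aperiodic_reset : aperiodic (reset L).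
Proof.
move=> H [Hc [e He eP]]; exists e; apply/seteqP; split=> [h Hh|_ -> //].
have [eh he [y Hy [hy yh]]] := eP _ Hh.
have hh : (h * h)%g = h by case: (h).
have E : (e * h)%g = e by rewrite -yh -mulgA hh.
by rewrite /= -E eh.
Qed.
End ResetBand.

(** What may stand below the leading aperiodic factor of a product with k
    groups. *)
Inductive tower : nat -> semigroupType -> Prop :=
| tower0 : tower 0 unit
| towerS k (G : finGroupType) W : kr_product k W -> tower k.+1 (wreath G W).

Lemma kr_product_tower k (A X : semigroupType) :
  enumerable A -> aperiodic A -> tower k X -> kr_product k (wreath A X).
Proof.
move=> fA aA; case=> [|{}k G W kW]; last by apply: kr_productS => //; exact/finite_setE.
apply: kr_product0; first exact/finite_setE/enumerable_wreath/enumerable_fin.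
by apply: aperiodic_wreath => //; exact: aperiodic_unit.
Qed.

Section Machines.
Variable M : Type.

(** The machine with transition function [delta] is simulated by A wr X. The
    leading factor A is kept apart, and its state is read off from A alone, so
    that further aperiodic factors can be merged into A. *)
Definition realizable (k : nat) (Z : Type) (z0 : Z) (delta : Z -> M -> Z) : Prop :=
  exists (A X : semigroupType) (sigma : M -> X) (dA : option X -> M -> A)
    (pi : option A -> option X -> Z),
  [/\ [/\ enumerable A, aperiodic A & tower k X], pi None None = z0 &
    forall a x s, pi (act a (dA x s)) (act x (sigma s)) = delta (pi a x) s].

Lemma realizable_unit : realizable 0 tt (fun _ _ => tt).
Proof.
exists unit, unit, (fun=> tt), (fun _ _ => tt), (fun _ _ => tt); split=> //.
by split; [exact: enumerable_fin|exact: aperiodic_unit|exact: tower0].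
Qed.

(** The reset may depend on the state of A as well as on that of X, so the new
    component is put above A; their wreath product is again aperiodic, and it
    becomes the leading factor. *)
Lemma realizable_reset k Z (z0 : Z) delta (L : finType) (rho : Z -> M -> option L) :
  realizable k z0 delta ->
  realizable k (None, z0) (fun u s =>
    (if rho u.2 s is Some c then Some c else u.1, delta u.2 s)).
Proof.
move=> [A [X [sigma [dA [pi [[fA aA tX] pi0 piS]]]]]].
exists (wreath (reset L) A), X, sigma,
  (fun x s => ((fun a => rho (pi a x) s) : option A -> reset L, dA x s)),
  (fun a x => if a is Some u then (u.1 None, pi (Some u.2) x) else (None, pi None x)).
split; [split=> //| by rewrite pi0|].
- by apply: enumerable_wreath => //; exact/enumerable_option/enumerable_fin.
- by apply: aperiodic_wreath => //; exact: aperiodic_reset.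
move=> [[f a]|] x s /=; rewrite -piS //=; last by case: (rho _ _).
by congr pair; case: (rho _ _).
Qed.

Lemma realizable_kr k Z (z0 : Z) delta : realizable k z0 delta ->
  exists (W : semigroupType) (sigma : M -> W) (pi : option W -> Z),
  [/\ kr_product k W, pi None = z0 &
    forall w s, pi (act w (sigma s)) = delta (pi w) s].
Proof.
move=> [A [X [sigma [dA [pi [[fA aA tX] pi0 piS]]]]]].
exists (wreath A X), (fun s => (dA^~ s, sigma s)),
  (fun w => if w is Some u then pi (Some (u.1 None)) (Some u.2) else pi None None).
split=> //; last by move=> [[f x]|] s /=; rewrite -piS.
exact: kr_product_tower.
Qed.

(** The group element depends on the state reached by the rest of the machine,
    which is the dependence that a wreath product with G allows; the leading
    aperiodic factor starts again from the trivial one. *)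
Lemma realizable_group k Z (z0 : Z) delta (G : finGroupType) (gamma : Z -> M -> G) :
  realizable k z0 delta ->
  realizable k.+1 (1%g, z0) (fun u s => ((u.1 * gamma u.2 s)%g, delta u.2 s)).
Proof.
move=> RR; have [W [sigma [pi [kW pi0 piS]]]] := realizable_kr RR.
exists unit, (wreath G W), (fun s => ((fun w => gamma (pi w) s), sigma s)),
  (fun _ _ => tt),
  (fun _ w => if w is Some u then (u.1 None, pi (Some u.2)) else (1%g, z0)).
split=> //.
  by split; [exact: enumerable_fin|exact: aperiodic_unit|exact: towerS].
by move=> _ [[f w]|] s /=; rewrite -?pi0 ?mul1g -piS.
Qed.
End Machines.

Lemma foldl_mulA (M : semigroupType) (x y : M) s :
  foldl *%g (x * y)%g s = (x * foldl *%g y s)%g.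
Proof. by elim: s y => [|z s IH] y //=; rewrite -mulgA IH. Qed.

(** The semigroup generated by the letters in the simulating product maps onto S
    by reading off the state reached from the initial state. *)
Lemma realizable_divides (M : semigroupType) (S : set M) k Z (z0 : Z) delta (out : Z -> M) :
  subsemigroup S -> realizable k z0 delta ->
  (forall s w, S s -> (forall t, t \in w -> S t) ->
    out (foldl delta z0 (s :: w)) = foldl *%g s w) ->
  divides_kr_product S k.
Proof.
move=> Sc RR outP; have [W [sigma [pi [kW pi0 piS]]]] := realizable_kr RR.
exists W => //.
pose word s w := foldl *%g (sigma s) (map sigma w).
pose inS (w : seq M) := forall t : M, t \in w -> S t.
have outE s w : S s -> inS w -> out (pi (Some (word s w))) = foldl *%g s w.
  move=> Ss Sw; rewrite -outP //=; congr out.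
  rewrite -pi0 -piS /word /=; elim: w (sigma s) {Sw} => //= t w IH x.
  by rewrite IH -[Some (x * _)%g]/(act (Some x) (sigma t)) piS.
have wordM s w t v : (word s w * word t v)%g = word s (w ++ t :: v).
  by rewrite /word map_cat foldl_cat /= foldl_mulA.
have catS w t v : inS w -> S t -> inS v -> inS (w ++ t :: v).
  move=> Sw St Sv u; rewrite mem_cat inE => /or3P[/Sw//|/eqP -> //|/Sv//].
exists [set x | exists s w, [/\ S s, inS w & x = word s w]],
  (fun x => out (pi (Some x))); split.
- move=> _ _ [s [w [Ss Sw ->]]] [t [v [St Sv ->]]]; exists s, (w ++ t :: v).
  by split=> //; exact: catS.
- move=> _ _ [s [w [Ss Sw ->]]] [t [v [St Sv ->]]].
  rewrite wordM !outE //; last exact: catS.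
  by rewrite foldl_cat /= foldl_mulA.
apply/seteqP; split=> [_ [_ [s [w [Ss Sw ->]]] <-]|s Ss].
  rewrite outE //; elim: w s Ss Sw => //= t w IH s Ss Sw; apply: IH.
    by apply: Sc => //; apply: Sw; rewrite mem_head.
  by move=> u uw; apply: Sw; rewrite inE uw orbT.
exists (word s [::]); first by exists s, [::].
by rewrite outE.
Qed.

Lemma perm_extend (T : finType) (A : {set T}) (f : T -> T) :
  {in A &, injective f} -> exists g : {perm T}, forall x, x \in A -> g x = f x.
Proof.
elim: {A}_.+1 {-2}A (ltnSn #|A|) => // k IH A Ak fI.
have [->|[x xA]] := set_0Vmem A; first by exists 1%g => x; rewrite inE.
have [||g gP] := IH (A :\ x)%SET.
- by move: Ak; rewrite (cardsD1 x) xA.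
- by move=> y z /setD1P[_ yA] /setD1P[_ zA]; exact: fI.
exists (g * tperm (g x) (f x))%g => y yA; rewrite permM.
have [->|yx] := eqVneq y x; first by rewrite tpermL.
have gy : g y = f y by apply: gP; rewrite !inE yx.
rewrite tpermD //; first by rewrite (inj_eq perm_inj) eq_sym.
by rewrite gy; apply: contra yx => /eqP/fI ->.
Qed.

Section UpperBound.
Variable n : nat.
Local Notation D := (partsg n).
Implicit Types (s t x y p : D) (Q : {set D}).

Definition all_brauer : {set D} := [set x | `[< brauer n x >]]%SET.
Definition img Q s : {set D} := [set ((x : D) * s)%g | x in Q]%SET.
Definition lideal t := img all_brauer t.

Lemma lidealP t y : reflect (exists2 x, brauer n x & y = (x * t)%g) (y \in lideal t).
Proof.
apply: (iffP imsetP) => [[x + ->]|[x bx ->]]; last by exists x => //; rewrite inE; apply/asboolP.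
by rewrite inE => /asboolP bx; exists x.
Qed.

Lemma img_lideal t s : img (lideal t) s = lideal (t * s)%g.
Proof. by rewrite /lideal /img -imset_comp; apply: eq_imset => x /=; rewrite mulgA. Qed.

Lemma lideal_refl t : t \in lideal t.
Proof. by apply/lidealP; exists (one n); [exact: brauer_one|rewrite one_mul]. Qed.

Lemma lidealS t y : brauer n t -> y \in lideal t -> lideal y \subset lideal t.
Proof.
move=> bt /lidealP[x bx ->]; apply/fintype.subsetP => _ /lidealP[z bz ->].
by apply/lidealP; exists (z * x)%g; [exact: brauer_mul|rewrite mulgA].
Qed.

Lemma rank_mulr s t : brauer n s -> brauer n t -> (rank (s * t)%g <= rank t)%N.
Proof.
move=> bs bt; rewrite -(rank_star bt) -(rank_star (brauer_mul bs bt)) starM.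
by apply: rank_mull; exact: brauer_star.
Qed.

Lemma rank_lideal t y : brauer n t -> y \in lideal t -> (rank y <= rank t)%N.
Proof. by move=> bt /lidealP[x bx ->]; exact: rank_mulr. Qed.

Lemma lideal_eq t y : brauer n t -> brauer n y -> y \in lideal t -> rank y = rank t ->
  lideal y = lideal t.
Proof.
move=> bt by_ yt rE; apply/eqP; rewrite finset.eqEsubset lidealS //=.
move/lidealP: yt rE => [x bx ->] /(stable_mull bx bt)[s bs tE].
by apply: lidealS; [exact: brauer_mul|apply/lidealP; exists s].
Qed.

(** The sets in which the running product is localised. Singletons occur because
    a value met before the rank drops is known exactly. *)
Definition small r Q := (#|Q| <= 1)%N \/
  exists t, [/\ brauer n t, (rank t <= r)%N & Q = lideal t].

Lemma small_img r Q s : brauer n s -> small r Q -> small r (img Q s).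
Proof.
move=> bs [Q1|[t [bt tr ->]]]; first by left; apply: leq_trans Q1; exact: leq_imset_card.
right; exists (t * s)%g; rewrite img_lideal; split=> //; first exact: brauer_mul.
by apply: leq_trans tr; exact: rank_mull.
Qed.

Lemma imgS Q Q' s : Q \subset Q' -> img Q s \subset img Q' s.
Proof. exact: imsetS. Qed.

(** A machine realizable with k groups whose states carry a small set q that
    contains the running product. The predicate [good] holds at the reachable
    states. *)
Definition tracks k r := exists (Z : Type) (z0 : Z) (delta : Z -> D -> Z)
    (q : Z -> {set D}) (good : Z -> Prop),
  [/\ realizable k z0 delta, good z0, q z0 = [set (one n)]%SET &
   forall z, good z -> small r (q z) /\ forall s, brauer n s ->
     good (delta z s) /\ img (q z) s \subset q (delta z s)].

Lemma tracks0 : tracks 0 n.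
Proof.
have := realizable_reset (fun (_ : unit) (_ : D) => Some tt) (realizable_unit D).
set delta := (X in realizable _ _ X) => RR.
exists (option unit * unit)%type, (None, tt), delta,
  (fun z => if z.1 is Some _ then lideal (one n) else [set (one n)]%SET), (fun=> True).
split=> // -[z1 z2] _; split.
  case: z1 => [_|] /=; last by left; rewrite cards1.
  by right; exists (one n); split=> //; [exact: brauer_one|exact: rank_le].
move=> s bs; split=> //=.
have -> : lideal (one n) = all_brauer.
  apply/setP => x; rewrite inE; apply/lidealP/asboolP => [[y by_ ->]|bx].
    by rewrite mul_one.
  by exists x; rewrite ?mul_one.
apply/fintype.subsetP => _ /imsetP[x xQ ->]; rewrite inE; apply/asboolP.
apply: brauer_mul bs; case: z1 xQ => [_|] /=; rewrite inE; first by move/asboolP.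
by move/eqP ->; exact: brauer_one.
Qed.

(** The sets that still have to be refined. Singletons are left alone. *)
Definition active r Q : bool := (1 < #|Q|)%N &&
  `[< exists t, [/\ brauer n t, rank t = r & Q = lideal t] >].

Lemma inactive_small r Q : odd n -> odd r -> small r Q -> ~~ active r Q -> small (r - 2) Q.
Proof.
move=> on or_ [Q1|[t [bt tr QE]]]; first by left.
rewrite negb_and -leqNgt => /orP[|/asboolPn nt]; first by left.
right; exists t; split=> //; have := rank_odd bt.
have : rank t <> r by move=> tE; apply: nt; exists t.
by move: tr; rewrite on; lia.
Qed.

(** While the machine passes between active sets by a bijection, a permutation g
    of all diagrams accumulates these bijections, and the refined set is the
    image by g of a constant set K. Whenever the machine enters an active set in
    another way, K is reset to the preimage by g of the set that is reached:
    either it comes from an inactive set, or it is the image of an ideal of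
    rank r that is not a full ideal of rank r, and by stability it is an ideal
    of smaller rank. *)
Lemma tracksS k r : odd n -> odd r -> tracks k r -> tracks k.+1 (r - 2).
Proof.
move=> on or_ [Z [z0 [delta [q [good [RR good0 q0 goodP]]]]]].
pose act z := active r (q z).
pose carry z s := [&& act z, act (delta z s) & img (q z) s == q (delta z s)].
have /choice[gam gamP] (zs : Z * D) : exists g : {perm D},
    if carry zs.1 zs.2 then forall x, brauer n zs.2 -> x \in q zs.1 -> g x = (x * zs.2)%g else g = 1%g.
  case: zs => z s /=; case cE: (carry z s); last by exists 1%g.
  case/and3P: cE => /andP[_ /asboolP[t [bt tr qE]]] /andP[_ /asboolP[t' [bt' tr' qE']]] /eqP.
  rewrite qE qE' img_lideal => tsE.
  have [bs|nbs] := pselect (brauer n s); last by exists 1%g => x bs.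
  have bts := brauer_mul bt bs.
  have [|s' bs' tE] := @stable_mulr _ s t bs bt.
    rewrite tr -tr'; apply/eqP; rewrite eqn_leq.
    apply/andP; split; apply: rank_lideal => //.
      by rewrite -tsE lideal_refl.
    by rewrite tsE lideal_refl.
  have [|g gP] := @perm_extend _ (lideal t) (fun x => (x * s)%g); last first.
    by exists g => x _; exact: gP.
  move=> _ _ /lidealP[x bx ->] /lidealP[y by_ ->] xy.
  have : (x * t * s * s')%g = (y * t * s * s')%g by rewrite xy.
  by rewrite -!mulgA (mulgA t) tE.
pose gamma z s := gam (z, s).
have {RR} := realizable_group gamma RR; set delta1 := (X in realizable _ _ X) => RR.
pose rho (u : {perm D} * Z) s : option {set D} :=
  if act (delta u.2 s) && ~~ carry u.2 s
  then Some [set (u.1^-1)%g x | x in img (q u.2) s]%SET else None.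
have {RR} := realizable_reset rho RR; set delta2 := (X in realizable _ _ X) => RR.
pose q' (v : option {set D} * ({perm D} * Z)) :=
  if act v.2.2 then if v.1 is Some K then [set v.2.1 x | x in K]%SET else finset.set0
  else q v.2.2.
exists _, (None, (1%g, z0)), delta2, q',
  (fun v => [/\ good v.2.2, q' v \subset q v.2.2 & small (r - 2) (q' v)]).
have act0 : act z0 = false by rewrite /act /active q0 cards1.
split=> //.
- have [sm0 _] := goodP _ good0.
  rewrite /q' /= act0; split=> //; apply: inactive_small => //.
  by rewrite -/(act _) act0.
- by rewrite /q' /= act0 q0.
move=> [K [g z]] [/= gz q'q q's]; split=> // s bs.
have [sz /(_ s bs)[gzs qsub]] := goodP _ gz; have [szs _] := goodP _ gzs.
have imq : img (q' (K, (g, z))) s \subset img (q z) s by exact: imgS.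
have qn : q' (delta2 (K, (g, z)) s) =
    if act (delta z s) then
      if carry z s then img (q' (K, (g, z))) s else img (q z) s
    else q (delta z s).
  rewrite {1}/q' /delta2 /delta1 /=; case: ifP => // az; rewrite /rho /= az /=.
  have gE := gamP (z, s); rewrite /= in gE.
  case cz: (carry z s) gE => /= gE; last first.
    rewrite /gamma gE mulg1 -imset_comp -[RHS]imset_id; apply: eq_imset => x.
    by rewrite /= permKV.
  rewrite /q' /=; case/and3P: (cz) => az' _ _; rewrite az'.
  case: K q'q {q's imq} => [K|] /=; rewrite /q' /= az' => q'q; last by rewrite /img imset0.
  rewrite /img -imset_comp; apply: eq_in_imset => x xK /=.
  by rewrite permM /gamma gE //; move/fintype.subsetP: q'q; apply; apply/imsetP; exists x.
rewrite qn; split; last first.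
  by case: ifP => _; [case: ifP => _|exact: (fintype.subset_trans _ qsub)].
split=> //=.
  by case: ifP => _ //; case: ifP => // _; exact: (fintype.subset_trans _ qsub).
case: ifP => [az|/negbT az]; last exact: inactive_small.
case: ifP => [_|/negbT cz]; first exact: small_img.
have [az'|az'] := boolP (act z); last exact/small_img/inactive_small.
move: (cz); rewrite /carry az' az /=; move/andP: az' => [_ /asboolP[t [bt tr qE]]].
move/andP: az => [_ /asboolP[t' [bt' tr' qE']]].
rewrite qE qE' img_lideal => neq; right; exists (t * s)%g.
have bts := brauer_mul bt bs; split=> //.
have := rank_mull bs bt; have := rank_odd bts; rewrite tr on.
suff : rank (t * s)%g <> r by move: (rank _) => x; lia.

move=> tsr; case/negP: neq; apply/eqP; apply: lideal_eq => //; last by rewrite tsr.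
move/fintype.subsetP: qsub => /(_ (t * s)%g).
by rewrite qE qE' img_lideal lideal_refl; apply.
Qed.

(** When the rank drops to 1, the value p0 of the product is known, and it is
    stored. From then on the product is p0 w, it lies in the left ideal of some
    t of rank 1, and it can be recovered as p0 t from the sandwich identity. *)
Lemma tracks1_divides k : odd n -> tracks k 1 -> divides_kr_product (brauer n) k.
Proof.
move=> on [Z [z0 [delta [q [good [RR good0 q0 goodP]]]]]].
pose act z := active 1 (q z).
have inact z : good z -> ~~ act z -> (#|q z| <= 1)%N.
  move=> /goodP[sz _] az; have [//|[t [bt]]] := inactive_small on (isT : odd 1) sz az.
  by have := rank_odd bt; case: (rank t) => //; rewrite on.
pose the z := odflt (one n) [pick x in q z].
have theE z x : good z -> ~~ act z -> x \in q z -> the z = x.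
  move=> gz az xq; rewrite /the; case: pickP => [y yq|/(_ x)]; last by rewrite xq.
  by apply/eqP/negPn/negP => yx; have := inact _ gz az; rewrite leqNgt (cardD1 x) xq (cardD1 y) !inE yx yq.
pose rho z s : option D := if act (delta z s) && ~~ act z then Some (the z * s)%g else None.
have {RR} := realizable_reset rho RR; set delta' := (X in realizable _ _ X) => RR.
pose gen z := odflt (one n) [pick t | [&& t \in all_brauer, rank t == 1 & q z == lideal t]].
pose out (v : option D * Z) := if act v.2 then (odflt (one n) v.1 * gen v.2)%g else the v.2.
pose inv (v : option D * Z) p := [/\ good v.2, brauer n p, p \in q v.2 &
  act v.2 -> exists p0 w, [/\ v.1 = Some p0, brauer n p0, rank p0 = 1, brauer n w & p = (p0 * w)%g]].
have invS v p s : brauer n s -> inv v p -> inv (delta' v s) (p * s)%g.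
  case: v => l z bs [/= gz bp pq actP].
  have [_ /(_ s bs)[gzs qsub]] := goodP _ gz.
  have psq : (p * s)%g \in q (delta z s).
    by apply: (fintype.subsetP qsub); exact: imset_f.
  have bps := brauer_mul bp bs.
  split=> //= az; rewrite /rho az /=.
  have [az'|az'] := boolP (act z).
    have [p0 [w [-> bp0 rp0 bw ->]]] := actP az'.
    by exists p0, (w * s)%g; rewrite mulgA; split=> //; exact: brauer_mul.
  rewrite (theE _ p) //; exists (p * s)%g, (one n); rewrite mul_one; split=> //; last exact: brauer_one.
  move/andP: az => [_ /asboolP[t [bt tr qE]]].
  have := rank_lideal bt; move/(_ (p * s)%g); rewrite -qE tr => /(_ psq).
  by have := rank_odd bps; case: (rank _) => [|[]] //; rewrite on.
have invout v p : inv v p -> out v = p.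
  case: v => l z [/= gz bp pq actP]; rewrite /out /=; case: ifP => [az|/negbT az]; last exact: theE.
  have [p0 [w [-> bp0 rp0 bw pE]]] := actP az; rewrite /=.
  move/andP: az => [_ /asboolP[t0 [bt0 tr0 qE0]]].
  rewrite /gen; case: pickP => [t|/(_ t0)]; last first.
    by rewrite inE tr0 qE0 !eqxx !andbT => /asboolP.
  rewrite inE => /and3P[/asboolP bt /eqP rt /eqP qE] /=.
  move: pq; rewrite qE => /lidealP[y by_ py].
  have tt : (t * t)%g = t.
    by rewrite -{1}(mul_one t) (rank1_sandwich bt rt) //; exact: brauer_one.
  have -> : p = (p0 * w * t)%g by rewrite -pE py -mulgA tt.
  rewrite -{2}(rank1_sandwich bt rt bp0) !mulgA -(mulgA p0) rank1_sandwich //.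
  exact: brauer_mul.
apply: (realizable_divides (out := out) _ RR); first by move=> *; exact: brauer_mul.
move=> s w bs bw; apply: invout => /=.
have : inv (delta' (None, z0) s) s.
  rewrite -{2}(one_mul s); apply: invS => //; split=> //=; first exact: brauer_one.
    by rewrite q0 inE.
  by rewrite /act /active q0 cards1.
elim: w s (delta' _ s) bw {bs} => //= t w IH s v bw vs; apply: IH.
  by move=> u uw; apply: bw; rewrite inE uw orbT.
by apply: invS => //; apply: bw; rewrite mem_head.
Qed.
End UpperBound.

Lemma brauer_upper m : (0 < m)%N ->
  divides_kr_product (brauer (2 * m - 1)) (m - 1).
Proof.
move=> m0; set n := (2 * m - 1)%N; have on : odd n by rewrite /n; lia.
have H k : (k < m)%N -> tracks n k (n - k.*2).
  elim: k => [|k IH] km; first by rewrite subn0; exact: tracks0.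
  have -> : (n - k.+1.*2 = n - k.*2 - 2)%N by lia.
  by apply: tracksS => //; [rewrite /n; lia|apply: IH; lia].
apply: tracks1_divides => //.
have := H (m - 1)%N; have -> : (n - (m - 1).*2)%N = 1 by rewrite /n; lia.
by apply; lia.
Qed.

(** * Nested rotations: the lower bound *)

Lemma conj_closure_pow (M : semigroupType) (z z' e u : M) k :
  conj_closure z z' e u -> conj_closure z z' e (pow u k).
Proof. by move=> cu; elim: k => //= k; exact: conj_mul. Qed.

(** Put rho = e z e. Then rho^r = (e z)^r e is the product of
    e, z e z^-1, ..., z^r e z^-r, as z^r = i. From rho^(r-2) = e it follows that
    rho^2 = rho^r, and, r being odd, that rho = rho^(r-1) is a power of rho^2. *)
Lemma conj_closure_rotation (M : semigroupType) (z z' i e : M) r :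
  unit_below z z' i e -> odd r -> (2 < r)%N -> pow z' r.-1 = i ->
  pow (e * z * e)%g (r - 3) = e -> conj_closure z z' e (e * z * e)%g.
Proof.
move=> ub odr r2 z'r; set rho := (e * z * e)%g => rhor.
have ee := ub_ee ub.
pose R a := iter a (fun x => (e * z * x)%g) e.
have eR a : (e * R a)%g = R a by case: a => [|a] /=; rewrite ?mulgA ee.
have Rrho a : R a.+1 = pow rho a.
  elim: a => [|a IH] //; rewrite powS -IH /rho -mulgA eR //.
have RT a : conj_closure z z' e (R a.+1 * pow z' a)%g.
  elim: a => [|a IH].
    rewrite /R /= -2!mulgA; apply: conj_mul; first exact: conj_base.
    by rewrite mulgA; apply: conj_conj; exact: conj_base.
  have -> : (R a.+2 * pow z' a.+1)%g = (e * (z * (R a.+1 * pow z' a) * z'))%g.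
    by rewrite -powSr /R /= !mulgA.
  by apply: conj_mul; [exact: conj_base|exact: conj_conj].
have Ri : (pow rho r.-1 * i)%g = pow rho r.-1.
  by case: (r.-1) => [|a]; rewrite -?powSr /rho -!mulgA (ub_ei ub).
have rho2 : conj_closure z z' e (pow rho 1).
  have := RT r.-1; rewrite z'r Rrho Ri.
  have -> : r.-1 = (r - 3 + 1).+1 by lia.
  by rewrite -powD rhor /= /rho !mulgA ee.
have -> : rho = pow (pow rho 1) (r./2 - 1).
  rewrite powM; have -> : (2 * (r./2 - 1).+1).-1 = (r - 3).+1 by lia.
  by rewrite -powSr rhor /rho !mulgA ee.
exact: conj_closure_pow.
Qed.

(* lia, keeping from the context only the inequalities between numbers *)
Ltac nlia := repeat match goal with
  | H : forall _, _ |- _ => clear H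
  | H : @eq bool _ _ |- _ => clear H
  end; lia.

Section Levels.
Variable m : nat.
Implicit Types (f g h : nat -> bool).

(** Colourings are extended to all natural numbers to allow for arithmetic on
    the positions. *)
Definition ext (f : 'I_m -> bool) (k : nat) : bool := oapp f false (insub k).

Lemma extE (f : 'I_m -> bool) (k : 'I_m) : ext f k = f k.
Proof. by rewrite /ext valK. Qed.

(** The rotation by a of the points 2j, ..., m - 1, for 0 <= a <= m - 2j. *)
Definition turn j a k := if (k + a < m)%N then (k + a)%N else (k + a - (m - j.*2))%N.

Ltac turns := rewrite /turn; repeat case: ifP; nlia.

Definition hooks j f := forall i, (i < j)%N -> f i.*2 = f i.*2.+1.

Definition turn_spec j a f g :=
  [/\ hooks j f, hooks j g &
    forall k, (j.*2 <= k < m)%N -> g (turn j a k) = f k].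

(** The diagram with hooks {0,1}, {2,3}, ..., {2j-2,2j-1} on both circles that
    rotates the other points by a, as the kernel of a labelling. *)
Definition turn_label j a (x : vertex m) : nat * nat :=
  match x with
  | inl k => if (k < j.*2)%N then (0, k./2) else (2, turn j a k)
  | inr k => if (k < j.*2)%N then (1, k./2) else (2, nat_of_ord k)
  end.

Definition turn_diag j a : partsg m := kernel (turn_label j a).

Definition bounded j a := (j.*2 <= m)%N && (a <= m - j.*2)%N.

Lemma respects_turn j a (f g : 'I_m -> bool) : bounded j a ->
  respects (turn_diag j a) f g <-> turn_spec j a (ext f) (ext g).
Proof.
move=> /andP[jm aj]; rewrite respects_kernel; split.
  move=> H; split.
  - move=> i ij; have h1 : (i.*2 < m)%N by lia. have h2 : (i.*2.+1 < m)%N by lia.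
    rewrite (extE f (Ordinal h1)) (extE f (Ordinal h2)).
    apply: (H (inl _) (inl _)); rewrite /=.
    have -> : (i.*2 < j.*2)%N by lia. have -> : (i.*2.+1 < j.*2)%N by lia.
    by congr pair; lia.
  - move=> i ij; have h1 : (i.*2 < m)%N by lia. have h2 : (i.*2.+1 < m)%N by lia.
    rewrite (extE g (Ordinal h1)) (extE g (Ordinal h2)).
    apply: (H (inr _) (inr _)); rewrite /=.
    have -> : (i.*2 < j.*2)%N by lia. have -> : (i.*2.+1 < j.*2)%N by lia.
    by congr pair; lia.
  - move=> k /andP[jk km]; have h2 : (turn j a k < m)%N by rewrite /turn; case: ifP; lia.
    rewrite (extE f (Ordinal km)) (extE g (Ordinal h2)).
    apply: (H (inr _) (inl _)); rewrite /=.
    have -> : (turn j a k < j.*2)%N = false by rewrite /turn; case: ifP; lia.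
    by have -> : (k < j.*2)%N = false by lia.
move=> [hf hg fg].
have hkE (F : 'I_m -> bool) (k l : 'I_m) : hooks j (ext F) -> (k < j.*2)%N ->
    (l < j.*2)%N -> k./2 = l./2 -> F k = F l.
  move=> hF kj lj kl; rewrite -!extE.
  have E (i : nat) : (i < j.*2)%N -> ext F i = ext F i./2.*2.
    by move=> ij; rewrite -{1}(odd_double_half i); case: (odd i) => //=; rewrite add1n -hF //; lia.
  by rewrite (E k) // (E l) // kl.
have fgE (k l : 'I_m) : (k < j.*2)%N = false -> turn j a k = l -> f k = g l.
  by move=> kj kl; rewrite -!extE -kl fg //; have := ltn_ord k; lia.
have tinj (k l : 'I_m) : (k < j.*2)%N = false -> (l < j.*2)%N = false ->
    turn j a k = turn j a l -> k = l.
  move=> kj lj; have := ltn_ord k; have := ltn_ord l; rewrite /turn => ? ? E.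
  by apply: val_inj => /=; move: E; do 2!case: ifP; lia.
move=> [k|k] [l|l] /=; case: ifP => kj; case: ifP => lj //= [] // E.
- exact: hkE.
- by rewrite (tinj k l).
- exact: fgE.
- by symmetry; exact: fgE.
- exact: hkE.
- by rewrite (val_inj E).
Qed.

Lemma turn_spec_ext j a f f' g g' : bounded j a ->
  (forall k, (k < m)%N -> f k = f' k) -> (forall k, (k < m)%N -> g k = g' k) ->
  turn_spec j a f g -> turn_spec j a f' g'.
Proof.
move=> /andP[jm aj] ff gg [hf hg fg]; split=> [i ij|i ij|k km].
- by rewrite -!ff ?hf //; lia.
- by rewrite -!gg ?hg //; lia.
rewrite -ff; last by lia.
by rewrite -fg // -gg //; rewrite /turn; case: ifP; lia.
Qed.

Lemma turn_diag_mul j a j' a' j'' a'' :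
  bounded j a -> bounded j' a' -> bounded j'' a'' ->
  (forall f g, turn_spec j'' a'' f g <->
     exists2 h, turn_spec j a f h & turn_spec j' a' h g) ->
  (turn_diag j a * turn_diag j' a')%g = turn_diag j'' a''.
Proof.
move=> b b' b'' H; apply: respects_inj => f g.
rewrite (respects_turn _ _ b'') H; split.
  case/respects_mul => h /(respects_turn _ _ b) fh /(respects_turn _ _ b') hg.
  by exists (ext h).
case=> h fh hg; apply/respects_mul; exists (fun k => h k).
  apply/(respects_turn _ _ b); apply: turn_spec_ext fh => // k km.
  by rewrite (extE _ (Ordinal km)).
apply/(respects_turn _ _ b'); apply: turn_spec_ext hg => // k km.
by rewrite (extE _ (Ordinal km)).
Qed.


Lemma turn_add j a b : bounded j (a + b) ->
  (turn_diag j a * turn_diag j b)%g = turn_diag j (a + b).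
Proof.
move=> bj; have /andP[jm abj] := bj.
apply: turn_diag_mul => //; try (apply/andP; split; lia).
move=> f g; split=> [[hf hg fg]|[h [hf hh fh] [_ hg hhg]]]; last first.
  split=> // k km; rewrite -fh // -hhg; last by turns.
  by congr g; turns.
exists (fun k => if (k < j.*2)%N then false else f (turn j (m - j.*2 - a) k)).
  split=> // [i ij|k km]; first by have -> : (i.*2 < j.*2)%N by [lia]; have -> : (i.*2.+1 < j.*2)%N by lia.
  have -> : (turn j a k < j.*2)%N = false by turns.
  by congr f; turns.
split=> // [i ij|k km]; first by have -> : (i.*2 < j.*2)%N by [lia]; have -> : (i.*2.+1 < j.*2)%N by lia.
have -> : (k < j.*2)%N = false by lia.
rewrite -fg; last by turns.
by congr g; turns.
Qed.

Lemma turn_full j : (j.*2 <= m)%N -> turn_diag j (m - j.*2) = turn_diag j 0.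
Proof.
move=> jm; apply: respects_inj => f g; rewrite !respects_turn ?/bounded; try lia.
have tE k : (j.*2 <= k < m)%N -> turn j (m - j.*2) k = turn j 0 k by move=> km; turns.
by split=> -[hf hg fg]; split=> // k km; move: (fg k km); rewrite tE.
Qed.

Lemma turn_pow j a : bounded j a.+1 -> pow (turn_diag j 1) a = turn_diag j a.+1.
Proof.
elim: a => // a IH b; rewrite powS IH ?turn_add ?add1n //.
by move: b; rewrite /bounded; lia.
Qed.

Lemma turn0K j : (j.*2 <= m)%N -> (turn_diag j 0 * turn_diag j 0)%g = turn_diag j 0.
Proof. by move=> jm; rewrite turn_add // /bounded jm. Qed.

Lemma turn0_le j : (j.+1.*2 <= m)%N ->
  (turn_diag j 0 * turn_diag j.+1 0)%g = turn_diag j.+1 0 /\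
  (turn_diag j.+1 0 * turn_diag j 0)%g = turn_diag j.+1 0.
Proof.
move=> jm.
have t0 i k : (i.*2 <= k < m)%N -> turn i 0 k = k by move=> km; turns.
have hS h : hooks j.+1 h <-> hooks j h /\ h j.*2 = h j.*2.+1.
  split=> [H|[H1 H2] i]; first by split=> [i ij|]; apply: H; lia.
  by rewrite ltnS leq_eqVlt => /orP[/eqP -> //|]; exact: H1.
have cut f : hooks j (fun k => if (k < j.*2)%N then false else f k).
  by move=> i ij; have -> : (i.*2 < j.*2)%N by [lia]; have -> : (i.*2.+1 < j.*2)%N by lia.
have cut1 f : f j.*2 = f j.*2.+1 -> hooks j.+1 (fun k => if (k < j.*2)%N then false else f k).
  move=> fj; apply/hS; split; first exact: cut.
  by have -> : (j.*2 < j.*2)%N = false by [lia]; have -> : (j.*2.+1 < j.*2)%N = false by lia.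
split; apply: turn_diag_mul; try (rewrite /bounded; lia);
  move=> f g; split=> [[hf hg fg]|[h [h1 h2 h3] [h4 h5 h6]]].
- move/hS: (hf) => [hf1 hf2].
  exists (fun k => if (k < j.*2)%N then false else f k); split=> //; try exact: cut1; try exact: cut.
    by move=> k km; rewrite t0 //; have -> : (k < j.*2)%N = false by lia.
  move=> k km; have -> : (k < j.*2)%N = false by lia.
  exact: fg.
- split=> //; last by move=> k km; rewrite h6 // -h3 ?t0 //; lia.
  apply/hS; split=> //; have [_] := (hS h).1 h4.
  by rewrite -!h3 ?t0 //; lia.
- move/hS: (hg) => [hg1 hg2].
  exists (fun k => if (k < j.*2)%N then false else g k); split=> //; try exact: cut1; try exact: cut.
    move=> k km; have := fg k km; rewrite t0 //.
    by have -> : (k < j.*2)%N = false by lia.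
  by move=> k km; rewrite t0 //; have -> : (k < j.*2)%N = false by lia.
- split=> //; last by move=> k km; rewrite -h3 // -(h6 (turn j.+1 0 k)) ?t0 //; rewrite ?t0 //; lia.
  apply/hS; split=> //; have [_] := (hS h).1 h2.
  by rewrite -(h6 j.*2) -?(h6 j.*2.+1) ?t0 //; lia.
Qed.

Lemma hooksS j h : hooks j.+1 h <-> hooks j h /\ h j.*2 = h j.*2.+1.
Proof.
split=> [H|[H1 H2] i]; first by split=> [i ij|]; apply: H; lia.
by rewrite ltnS leq_eqVlt => /orP[/eqP -> //|]; exact: H1.
Qed.

Lemma turn0 i k : (i.*2 <= k < m)%N -> turn i 0 k = k.
Proof. by move=> km; turns. Qed.

(** The string that is rotated to the point 2j runs through the two hooks at
    2j, 2j+1 and leaves at 2j+2; so the points after 2j+1 are again rotated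
    by one. *)
Lemma turn_sandwich j : (j.+1.*2 < m)%N ->
  (turn_diag j.+1 0 * turn_diag j 1 * turn_diag j.+1 0)%g = turn_diag j.+1 1.
Proof.
move=> jm.
have bj : bounded j 1 by rewrite /bounded; nlia.
have bS0 : bounded j.+1 0 by rewrite /bounded; nlia.
have bS1 : bounded j.+1 1 by rewrite /bounded; nlia.
have t1 i k : (i.*2 <= k)%N -> (k.+1 < m)%N -> turn i 1 k = k.+1 by move=> *; turns.
have tm i : (i.*2 < m)%N -> turn i 1 m.-1 = i.*2 by move=> *; turns.
apply: respects_inj => f g; rewrite (respects_turn _ _ bS1); split.
  case/respects_mul => h2 /respects_mul[h1].
  move=> /(respects_turn _ _ bS0)[hf hh1 fh] /(respects_turn _ _ bj)[_ hh2 hh].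
  move=> /(respects_turn _ _ bS0)[hh3 hg hg2].
  move: hh1 fh hh2 hh hh3 hg2; move: (ext h1) (ext h2) => {}h1 {}h2.
  move=> /hooksS[_ hh1] fh _ hh /hooksS[_ hh2] hg2.
  split=> // k /andP[jk km].
  have fh' l : (j.+1.*2 <= l < m)%N -> ext f l = h1 l by move=> lm; rewrite -fh // turn0.
  have hg' l : (j.+1.*2 <= l < m)%N -> ext g l = h2 l by move=> lm; rewrite -hg2 // turn0.
  have [km'|km'] := ltnP k.+1 m.
    rewrite t1 // hg' ?fh'; [|nlia|nlia].
    by rewrite -hh ?t1 //; nlia.
  have -> : k = m.-1 by nlia.
  rewrite tm // hg' ?fh'; [|nlia|nlia].
  have E1 : h2 j.*2.+1 = h1 j.*2 by rewrite -hh ?t1 //; nlia.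
  have E2 : h2 j.+1.*2 = h1 j.*2.+1 by rewrite -hh ?t1 //; nlia.
  have E3 : h2 j.*2 = h1 m.-1 by rewrite -hh ?tm //; nlia.
  by rewrite E2 -hh1 -E1 -hh2 E3.
move=> [/hooksS[hf hfj] /hooksS[hg hgj] fg].
(* the string from m - 1 to 2j + 2 visits 2j and 2j + 1 in between *)
pose mid (h : nat -> bool) k := if (k < j.*2)%N then false
  else if (k < j.+1.*2)%N then ext f m.-1 else h k.
have lo h k : (k < j.*2)%N -> mid h k = false by rewrite /mid => ->.
have me h k : (j.*2 <= k < j.+1.*2)%N -> mid h k = ext f m.-1.
  move=> kj; rewrite /mid; have -> : (k < j.*2)%N = false by nlia.
  by have -> : (k < j.+1.*2)%N by nlia.
have hi h k : (j.+1.*2 <= k)%N -> mid h k = h k.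
  move=> kj; rewrite /mid; have -> : (k < j.*2)%N = false by nlia.
  by have -> : (k < j.+1.*2)%N = false by nlia.
have hmid h : hooks j (mid h) by move=> i ij; rewrite !lo //; nlia.
have hmidS h : hooks j.+1 (mid h) by apply/hooksS; split=> //; rewrite !me //; nlia.
have midE (h : nat -> bool) k : (k < m)%N -> ext (fun k : 'I_m => mid h k) k = mid h k.
  by move=> km; rewrite (extE _ (Ordinal km)).
have hmid' h : hooks j (ext (fun k : 'I_m => mid h k)).
  by move=> i ij; rewrite !midE ?hmid //; nlia.
have hmidS' h : hooks j.+1 (ext (fun k : 'I_m => mid h k)).
  by move=> i ij; rewrite !midE ?hmidS //; nlia.
apply/respects_mul; exists (fun k => mid (ext g) k).
  apply/respects_mul; exists (fun k => mid (ext f) k).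
    apply/(respects_turn _ _ bS0); split=> //; first exact/hooksS.
    by move=> k km; rewrite turn0 // midE ?hi //; nlia.
  apply/(respects_turn _ _ bj); split=> // k /andP[jk km].
  have [km'|km'] := ltnP k.+1 m; last first.
    have -> : k = m.-1 by nlia.
    rewrite tm; last by nlia.
    by rewrite !midE ?(me (ext g)) ?hi //; nlia.
  rewrite t1 // !midE //.
  have [kj|kj] := ltnP k j.+1.*2; last first.
    rewrite !hi //; last by nlia.
    by rewrite -fg ?t1 //; nlia.
  rewrite (me (ext f)); last by nlia.
  have [kj'|kj'] := ltnP k.+1 j.+1.*2; first by rewrite me //; nlia.
  rewrite hi //; have -> : k.+1 = j.+1.*2 by nlia.
  by rewrite -(tm j.+1) // fg //; nlia.
apply/(respects_turn _ _ bS0); split=> //; first exact/hooksS.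
by move=> k km; rewrite turn0 // midE ?hi //; nlia.
Qed.

(** Conjugating the hook {2j,2j+1} by the rotation by 2 moves it to the next
    two points. *)
Lemma turn_next_hook j : (j.+2.*2 <= m)%N ->
  (turn_diag j.+1 0 * (turn_diag j (m - j.*2 - 2) * turn_diag j.+1 0 * turn_diag j 2))%g =
  turn_diag j.+2 0.
Proof.
move=> jm; set r2 := (m - j.*2 - 2)%N.
have bj : bounded j r2 by rewrite /bounded; nlia.
have bj2 : bounded j 2 by rewrite /bounded; nlia.
have bS0 : bounded j.+1 0 by rewrite /bounded; nlia.
have bS2 : bounded j.+2 0 by rewrite /bounded; nlia.
have t2 k : (j.*2 <= k)%N -> (k.+2 < m)%N -> turn j 2 k = k.+2 by move=> *; turns.
have t2m : turn j 2 m.-2 = j.*2 by turns.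
have t2m1 : turn j 2 m.-1 = j.*2.+1 by turns.
have tr2 k : (j.+1.*2 <= k < m)%N -> turn j r2 k = k.-2 by rewrite /r2 => *; turns.
have tr0 : turn j r2 j.*2 = m.-2 by rewrite /r2; turns.
have tr1 : turn j r2 j.*2.+1 = m.-1 by rewrite /r2; turns.
apply: respects_inj => f g; rewrite (respects_turn _ _ bS2); split.
  case/respects_mul => h1 /(respects_turn _ _ bS0)[hf hh1 fh].
  case/respects_mul => h3 /respects_mul[h2].
  move=> /(respects_turn _ _ bj)[_ _ h12] /(respects_turn _ _ bS0)[hh2 hh3 h23].
  move=> /(respects_turn _ _ bj2)[_ hg h3g].
  move: hh1 fh h12 hh2 hh3 h23 h3g; move: (ext h1) (ext h2) (ext h3) => {}h1 {}h2 {}h3.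
  move=> /hooksS[_ hh1] fh h12 /hooksS[_ hh2] /hooksS[_ hh3] h23 h3g.
  have fE l : (j.+1.*2 <= l < m)%N -> ext f l = h1 l by move=> lm; rewrite -fh // turn0.
  have h23E l : (j.+1.*2 <= l < m)%N -> h2 l = h3 l by move=> lm; rewrite -h23 // turn0.
  have h1E l : (j.+1.*2 <= l < m)%N -> h1 l = h2 l.-2 by move=> lm; rewrite -h12 ?tr2 //; nlia.
  have gE l : (j.+1.*2 <= l < m)%N -> ext g l = h3 l.-2.
    by move=> lm; rewrite -h3g ?t2; [congr (ext g); nlia|nlia..].
  split.
  - apply/hooksS; split=> //; rewrite !fE ?h1E; [|nlia..].
    by have -> : j.+1.*2.-2 = j.*2 by [nlia]; have -> : j.+1.*2.+1.-2 = j.*2.+1 by nlia.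
  - apply/hooksS; split.
      apply/hooksS; split=> //.
      have G0 : ext g j.*2 = h3 m.-2 by rewrite -h3g ?t2m //; nlia.
      have G1 : ext g j.*2.+1 = h3 m.-1 by rewrite -h3g ?t2m1 //; nlia.
      have H0 : h1 j.*2 = h2 m.-2 by rewrite -h12 ?tr0 //; nlia.
      have H1 : h1 j.*2.+1 = h2 m.-1 by rewrite -h12 ?tr1 //; nlia.
      by rewrite G0 G1 -!h23E -?H0 -?H1 //; nlia.
    rewrite !gE; [|nlia..].
    by have -> : j.+1.*2.-2 = j.*2 by [nlia]; have -> : j.+1.*2.+1.-2 = j.*2.+1 by nlia.
  - move=> k km; rewrite turn0 // gE ?fE ?h1E; [|nlia..].
    by rewrite h23E //; nlia.
move=> [/hooksS[hf hf1] /hooksS[/hooksS[hg hg0] hg1] fg].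
have fgE k : (j.+2.*2 <= k < m)%N -> ext g k = ext f k by move=> km; rewrite -fg // turn0.
pose h1 k := if (k < j.*2)%N then false else if (k < j.+1.*2)%N then ext g j.*2 else ext f k.
pose h2 k := if (k < j.*2)%N then false else h1 (turn j 2 k).
pose h3 k := if (k < j.*2)%N then false else if (k < j.+1.*2)%N then ext g j.+1.*2 else h2 k.
have resE (h : nat -> bool) k : (k < m)%N -> ext (fun k : 'I_m => h k) k = h k.
  by move=> km; rewrite (extE _ (Ordinal km)).
have reshooks i (h : nat -> bool) : (i.*2 <= m)%N -> hooks i h -> hooks i (ext (fun k : 'I_m => h k)).
  by move=> im hh l li; rewrite !resE ?hh //; nlia.
have h1lo k : (k < j.*2)%N -> h1 k = false by rewrite /h1 => ->.
have h1me k : (j.*2 <= k < j.+1.*2)%N -> h1 k = ext g j.*2.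
  move=> kj; rewrite /h1; have -> : (k < j.*2)%N = false by nlia.
  by have -> : (k < j.+1.*2)%N by nlia.
have h1hi k : (j.+1.*2 <= k)%N -> h1 k = ext f k.
  move=> kj; rewrite /h1; have -> : (k < j.*2)%N = false by nlia.
  by have -> : (k < j.+1.*2)%N = false by nlia.
have h2lo k : (k < j.*2)%N -> h2 k = false by rewrite /h2 => ->.
have h2hi k : (j.*2 <= k)%N -> h2 k = h1 (turn j 2 k).
  by move=> kj; rewrite /h2; have -> : (k < j.*2)%N = false by nlia.
have h3lo k : (k < j.*2)%N -> h3 k = false by rewrite /h3 => ->.
have h3me k : (j.*2 <= k < j.+1.*2)%N -> h3 k = ext g j.+1.*2.
  move=> kj; rewrite /h3; have -> : (k < j.*2)%N = false by nlia.
  by have -> : (k < j.+1.*2)%N by nlia.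
have h3hi k : (j.+1.*2 <= k)%N -> h3 k = h2 k.
  move=> kj; rewrite /h3; have -> : (k < j.*2)%N = false by nlia.
  by have -> : (k < j.+1.*2)%N = false by nlia.
have k1 : hooks j.+1 h1.
  by apply/hooksS; split=> [i ij|]; [rewrite !h1lo //|rewrite !h1me //]; nlia.
have k2 : hooks j.+1 h2.
  apply/hooksS; split=> [i ij|]; first by rewrite !h2lo //; nlia.
  rewrite !h2hi ?t2; [|nlia..]; rewrite !h1hi; [|nlia..].
  exact: hf1.
have k3 : hooks j.+1 h3.
  by apply/hooksS; split=> [i ij|]; [rewrite !h3lo //|rewrite !h3me //]; nlia.
apply/respects_mul; exists (fun k => h1 k).
  apply/(respects_turn _ _ bS0); split=> //; first by apply: reshooks => //; nlia.
  by move=> k km; rewrite turn0 // resE ?h1hi //; nlia.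
apply/respects_mul; exists (fun k => h3 k).
  apply/respects_mul; exists (fun k => h2 k).
    apply/(respects_turn _ _ bj); split.
    - by apply: reshooks; [nlia|move/hooksS: k1 => []].
    - by apply: reshooks; [nlia|move/hooksS: k2 => []].
    move=> k km; have tl : (j.*2 <= turn j r2 k < m)%N by rewrite /r2; turns.
    rewrite !resE ?h2hi; [|nlia..]; congr h1; rewrite /r2; turns.
  apply/(respects_turn _ _ bS0); split; try by apply: reshooks => //; nlia.
  by move=> k km; rewrite turn0 // !resE ?h3hi //; nlia.
apply/(respects_turn _ _ bj2); split=> //.
  by apply: reshooks; [nlia|move/hooksS: k3 => []].
move=> k /andP[jk km]; rewrite resE //.
have [kj|kj] := ltnP k j.+1.*2.
  rewrite h3me ?t2; [|nlia..].
  have [->|->] : k = j.*2 \/ k = j.*2.+1 by nlia.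
    by congr (ext g); nlia.
  by rewrite [RHS]hg1; congr (ext g); nlia.
rewrite h3hi // h2hi //.
have [km'|km'] := ltnP k.+2 m.
  by rewrite t2 // h1hi ?fgE //; nlia.
have [->|->] : k = m.-2 \/ k = m.-1 by nlia.
  by rewrite t2m h1me //; nlia.
by rewrite t2m1 h1me ?hg0 //; nlia.
Qed.

(** The semigroup generated by the rotation of the points after 2j and the hook
    at the first two of them, a copy of the corresponding semigroup in degree
    m - 2j. *)
Inductive level (j : nat) : partsg m -> Prop :=
| level_turn : level j (turn_diag j 1)
| level_hook : (j.+1.*2 < m)%N -> level j (turn_diag j.+1 0)
| level_mul u v : level j u -> level j v -> level j (u * v)%g.

Lemma turn_unit_below j : (j.+1.*2 < m)%N ->
  unit_below (turn_diag j 1) (turn_diag j (m - j.*2 - 1)) (turn_diag j 0)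
    (turn_diag j.+1 0).
Proof.
move=> jm; have [] := @turn0_le j; first by lia.
have b a : (a <= m - j.*2)%N -> bounded j a by rewrite /bounded; lia.
move=> h1 h2; split=> //; rewrite ?turn_add ?addn0 ?add0n //; try apply: b; try lia.
- by have -> : (1 + (m - j.*2 - 1) = m - j.*2)%N by [lia]; rewrite turn_full //; lia.
- by have -> : (m - j.*2 - 1 + 1 = m - j.*2)%N by [lia]; rewrite turn_full //; lia.
- by rewrite /bounded; lia.
Qed.

Lemma turn_order j : (j.*2 < m)%N ->
  pow (turn_diag j 1) (m - j.*2).-1 = turn_diag j 0.
Proof.
move=> jm; rewrite turn_pow ?prednK ?turn_full // /bounded; lia.
Qed.

Lemma turn_neq j : (j.+1.*2 < m)%N -> turn_diag j 1 <> turn_diag j 0.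
Proof.
move=> jm E; have km : (m.-1 < m)%N by lia.
pose f (k : 'I_m) := k == Ordinal km.
have fE k : (k < m)%N -> ext f k = (k == m.-1).
  by move=> kk; rewrite (extE f (Ordinal kk)).
have : respects (turn_diag j 0) f f.
  apply/respects_turn; first by rewrite /bounded; lia.
  split=> [i ij|i ij|k kk]; try by rewrite !fE; lia.
  by rewrite turn0.
rewrite -E => /respects_turn [|_ _ /(_ m.-1)]; first by rewrite /bounded; lia.
have -> : turn j 1 m.-1 = j.*2 by turns.
by rewrite !fE; lia.
Qed.

Lemma conj_closure_turn j a b u : (j.+1.*2 < m)%N -> (a + b = m - j.*2)%N -> (0 < b)%N ->
  let C := conj_closure (turn_diag j 1) (turn_diag j (m - j.*2 - 1)) (turn_diag j.+1 0) in
  C u -> (turn_diag j 0 * u * turn_diag j 0)%g = u -> C (turn_diag j a * u * turn_diag j b)%g.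
Proof.
move=> jm ab b0 C Cu uE; have bd c : (c <= m - j.*2)%N -> bounded j c by rewrite /bounded; lia.
elim: a b ab b0 => [|a IH] b ab b0.
  by rewrite add0n in ab; rewrite ab turn_full ?uE //; lia.
have -> : (turn_diag j a.+1 * u * turn_diag j b =
  turn_diag j 1 * (turn_diag j a * u * turn_diag j b.+1) * turn_diag j (m - j.*2 - 1))%g.
  have E1 : turn_diag j a.+1 = (turn_diag j 1 * turn_diag j a)%g.
    by rewrite turn_add ?add1n //; apply: bd; lia.
  have E2 : turn_diag j b = (turn_diag j b.+1 * turn_diag j (m - j.*2 - 1))%g.
    rewrite -addn1 -turn_add; last by apply: bd; lia.
    rewrite -mulgA turn_add; last by apply: bd; lia.
    have -> : (1 + (m - j.*2 - 1) = m - j.*2)%N by lia.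
    rewrite turn_full; last by lia.
    by rewrite turn_add ?addn0 //; apply: bd; lia.
  by rewrite E1 E2 !mulgA.
by apply: conj_conj; apply: IH; lia.
Qed.

(** Both generators of the next level are products of conjugates of the
    idempotent of this level: the rotation by [conj_closure_rotation], the hook
    by [turn_next_hook]. *)
Lemma level_sub j u : odd m -> (j.+1.*2 < m)%N -> level j.+1 u ->
  conj_closure (turn_diag j 1) (turn_diag j (m - j.*2 - 1)) (turn_diag j.+1 0) u.
Proof.
move=> om jm; have ub := turn_unit_below jm.
have bd c : (c <= m - j.*2)%N -> bounded j c by rewrite /bounded; lia.
elim=> [|jm'|{}u v _ Cu _ Cv]; last exact: conj_mul.
- rewrite -turn_sandwich //.
  apply: (conj_closure_rotation ub (r := (m - j.*2)%N)); [lia|lia| |].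
  + have -> : turn_diag j (m - j.*2 - 1) = pow (turn_diag j 1) (m - j.*2 - 2).
      by rewrite turn_pow; [congr turn_diag; lia|apply: bd; lia].
    rewrite powM.
    have -> : (((m - j.*2 - 2).+1 * (m - j.*2).-1.+1).-1 =
               ((m - j.*2).-1.+1 * (m - j.*2 - 2).+1).-1)%N by rewrite mulnC.
    rewrite -powM turn_order; last by lia.
    by rewrite pow_idem // turn0K //; lia.
  + rewrite turn_sandwich //.
    have -> : (m - j.*2 - 3 = (m - j.+1.*2).-1)%N by lia.
    by rewrite turn_order.
- rewrite -turn_next_hook; last by lia.
  apply: conj_mul; first exact: conj_base.
  apply: conj_closure_turn => //; [lia|exact: conj_base|].
  by rewrite (ub_ie ub) (ub_ei ub).
Qed.

Lemma level_absorb j u : (j.*2 < m)%N -> level j u -> (turn_diag j 0 * u)%g = u.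
Proof.
move=> jm; elim=> [|jm'|{}u v _ IHu _ _]; last by rewrite mulgA IHu.
- by rewrite turn_add // /bounded; lia.
- by have [] := @turn0_le j; first by lia.
Qed.

Lemma level_complexity j k : odd m -> (j.*2 < m)%N ->
  divides_kr_product (level j) k -> ((m - j.*2)./2 <= k)%N.
Proof.
move=> om; move E : (m./2 - j)%N => d; elim: d j k E => [|d IH] j k E jm; first by lia.
have jm' : (j.+1.*2 < m)%N by lia.
have ub := turn_unit_below jm'.
case: k => [|k] [W kW dW].
  have := divides_aperiodic ub (turn_order jm) (level_turn j) (level_hook jm') kW dW.
  by move/turn_neq => /(_ jm').
have dS : divides_kr_product (level j.+1) k.
  apply: (divides_peel ub (turn_order jm) (level_turn j) (level_hook jm') _ _ _ kW dW).
  - by move=> u v; exact: level_mul.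
  - by move=> u; exact: level_sub.
  - by move=> u; exact: level_absorb.
have Ed : (m./2 - j.+1 = d)%N by lia.
by have := IH j.+1 k Ed jm' dS; lia.
Qed.
End Levels.

Import Order.TTheory GRing.Theory Num.Theory.
Import numFieldNormedType.Exports.

(** * Paths in the annulus *)

Section ContinuityInFields.
Local Open Scope ring_scope.

Lemma radial_cvg (K : numFieldType) (a b z : K) : z != 0 ->
  (a + b / `|w|) * w @[w --> z] --> (a + b / `|z|) * z.
Proof.
move=> z0.
have FF : Filter (nbhs z) by exact: nbhs_filter.
have h2 : `|w|^-1 @[w --> z] --> `|z|^-1.
  apply: cvgV; [by rewrite normr_eq0|exact: norm_continuous].
have h3 := @cvgM K _ (nbhs z) FF (fun=> b) (fun w : K => `|w|^-1) _ _ (@cvg_cst _ _ _ _ FF) h2.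
have h4 := @cvgD K K _ (nbhs z) FF (fun=> a) _ _ _ (@cvg_cst _ _ _ _ FF) h3.
exact: (@cvgM K _ (nbhs z) FF _ (fun w : K => w) _ _ h4 (@cvg_id _ _)).
Qed.

Lemma cartesian_cvg (T : topologicalType) (K : numFieldType) (i : K) (f g h : T -> K) (t : T) :
  {for t, continuous f} -> {for t, continuous g} -> {for t, continuous h} ->
  (fun x => f x * (g x + i * h x)) x @[x --> t] --> f t * (g t + i * h t).
Proof.
move=> cf cg ch; apply: cvgM => //; apply: cvgD => //; apply: cvgM => //; exact: cvg_cst.
Qed.

End ContinuityInFields.

(* lra, after discarding the equations that are not between real numbers *)
Ltac rlra := repeat match goal with H : @eq ?T _ _ |- _ =>
  lazymatch T with context [complex] => clear H end end; lra.

Section ComplexPlane.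
Local Open Scope ring_scope.
Variable R : realType.
Implicit Types (z w : R[i]^o) (a b r t : R).
Local Notation cn := (@Normc.normc R).

Lemma normE (z : R[i]) : `|z| = (Normc.normc z)%:C%C.
Proof. by case: z => a b; rewrite normc_def. Qed.

Lemma realC_continuous : continuous (fun x : R => (x%:C)%C : R[i]^o).
Proof.
move=> x; apply/cvgrPdist_lt => e e0.
have eE : e = ((complex.Re e)%:C)%C.
  by apply/eqP; rewrite eq_complex /= eqxx /=; move: e0; rewrite ltcE => /andP[/eqP -> _].
have e0' : 0 < complex.Re e by move: e0; rewrite ltcE => /andP[].
near=> y.
rewrite -rmorphB /= normE eE ltcR /Normc.normc /= expr0n addr0 sqrtr_sqr.
near: y. apply: cvgr_dist_lt => //; exact: cvg_id.
Unshelve. all: by end_near.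
Qed.


Lemma radial_continuous (a b : R) (z : R[i]^o) : z != 0 ->
  {for z, continuous (fun z : R[i]^o => (a%:C + b%:C / `|z|)%C * z : R[i]^o)}.
Proof. exact: (@radial_cvg R[i] (a%:C)%C (b%:C)%C z). Qed.

Definition cis a : R[i] := (cos a +i* sin a)%C.
Definition polar r a : R[i]^o := (r%:C)%C * cis a.
(** For b = 1/2 and b = 1 this squeezes the annulus radially into its inner and
    its outer half. *)
Definition radial b z : R[i]^o := ((2^-1)%:C + b%:C / `|z|)%C * z.

Lemma annulusE z : annulus z <-> 1 < cn z < 2.
Proof.
rewrite /annulus /= normE.
have -> : (1 : R[i]) = (1 : R)%:C%C by [].
have -> : (2 : R[i]) = (2 : R)%:C%C by rewrite rmorph_nat.
by rewrite !ltcR.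
Qed.

Lemma cn_real r : cn (r%:C)%C = `|r|.
Proof. by rewrite /Normc.normc /= expr0n addr0 sqrtr_sqr. Qed.

Lemma cn_polar r a : 0 <= r -> cn (polar r a) = r.
Proof.
move=> r0; rewrite /polar Normc.normcM cn_real ger0_norm //.
by rewrite /Normc.normc /= cos2Dsin2 sqrtr1 mulr1.
Qed.

Lemma cn_gt0_neq0 z : 0 < cn z -> z != 0.
Proof. by move=> z0; apply: contraTneq z0 => ->; rewrite Normc.normc0 ltxx. Qed.

Lemma radialE b z : 0 < cn z -> radial b z = ((2^-1 + b / cn z)%:C)%C * z.
Proof. by move=> z0; rewrite /radial normE rmorphD rmorphM !fmorphV. Qed.

Lemma cn_radial b z : 0 <= b -> 0 < cn z -> cn (radial b z) = cn z / 2 + b.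
Proof.
move=> b0 z0; rewrite radialE // Normc.normcM cn_real.
rewrite ger0_norm; last by rewrite addr_ge0 ?divr_ge0 ?invr_ge0 ?ler0n // ltW.
by field; rewrite gt_eqF.
Qed.

Lemma radial_inj b z w : 0 <= b -> 0 < cn z -> 0 < cn w -> radial b z = radial b w -> z = w.
Proof.
move=> b0 z0 w0 zw; have : cn (radial b z) = cn (radial b w) by rewrite zw.
rewrite !cn_radial // => cnE; have {}cnE : cn z = cn w by lra.
move: zw; rewrite !radialE // cnE => /mulfI; apply.
rewrite (_ : 0 = 0%:C%C) // (inj_eq (@complexI _)) gt_eqF //.
by rewrite ltr_pwDl ?invr_gt0 ?ltr0n // divr_ge0 // ltW.
Qed.

Lemma radial_polar b r a : 0 < r -> radial b (polar r a) = polar (r / 2 + b) a.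
Proof.
move=> r0; rewrite radialE cn_polar ?ltW // /polar mulrA -rmorphM /=.
by congr ((_)%:C%C * _); field; rewrite gt_eqF.
Qed.

Lemma cos_eq1 t : `|t| < pi *+ 2 -> cos t = 1 -> t = 0.
Proof.
move=> t2 ct; apply/eqP; rewrite -normr_le0 leNgt; apply/negP => t0.
have ct' : cos `|t| = 1 by case: (ger0P t); rewrite ?cosN.
have : 0 < sin (`|t| / 2).
  by apply: sin_gt0_pi; rewrite divr_gt0 // ltr_pdivrMr // mulr_natr.
have : sin (`|t| / 2) ^+ 2 = 0.
  have := cos2Dsin2 (`|t| / 2); have := cosD (`|t| / 2) (`|t| / 2).
  by rewrite -splitr ct' -!expr2 => h1 h2; lra.
by move/eqP; rewrite sqrf_eq0 => /eqP ->; rewrite ltxx.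
Qed.

Lemma polar_inj r r' a b : 0 < r -> 0 < r' -> polar r a = polar r' b ->
  r = r' /\ (`|a - b| < pi *+ 2 -> a = b).
Proof.
move=> r0 r0' E; have rr : r = r'.
  by rewrite -(cn_polar a (ltW r0)) E cn_polar // ltW.
split=> // ab; apply/eqP; rewrite -subr_eq0; apply/eqP/cos_eq1 => //.
have nz : (r'%:C)%C != 0 by rewrite (_ : 0 = 0%:C%C) // (inj_eq (@complexI _)) gt_eqF.
move: E; rewrite /polar rr => /(mulfI nz)[ca sa].
by rewrite cosB ca sa -!expr2 cos2Dsin2.
Qed.

Lemma polar_continuous (r a : R -> R) : continuous r -> continuous a ->
  continuous (fun t => polar (r t) (a t)).
Proof.
move=> cr ca t; pose K : numFieldType := R[i].
have cC (f : R -> R) : continuous f -> (fun t => (f t)%:C%C : K) x @[x --> t] --> ((f t)%:C%C : K).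
  move=> cf; apply: (@continuous_comp _ _ K f (fun x => x%:C%C)); first exact: cf.
  exact: realC_continuous.
have ccos : continuous (cos \o a) by move=> x; apply: continuous_comp; [exact: ca|exact: continuous_cos].
have csin : continuous (sin \o a) by move=> x; apply: continuous_comp; [exact: ca|exact: continuous_sin].
have polE x : polar (r x) (a x) = (r x)%:C%C * ((cos (a x))%:C%C + 'i%C * (sin (a x))%:C%C).
  rewrite /polar /cis; congr (_ * _); apply/eqP; rewrite eq_complex /=.
  by apply/andP; split; apply/eqP; ring.
rewrite /continuous_at polE (_ : (fun t => _) =
  fun x => (r x)%:C%C * ((cos (a x))%:C%C + 'i%C * (sin (a x))%:C%C)).
  by apply: (@cartesian_cvg R R[i]); exact: cC.
by apply/funext.
Qed.

Definition joined (K : set R[i]^o) (p q : R[i]^o) : Prop :=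
  exists g : R -> R[i]^o, [/\ {within `[0, 1], continuous g}, g 0 = p, g 1 = q,
    forall t, 0 < t < 1 -> annulus (g t) & forall t, 0 <= t <= 1 -> K (g t)].

Lemma sub_joined (K K' : set R[i]^o) p q : K `<=` K' -> joined K p q -> joined K' p q.
Proof. by move=> KK [g [gc g0 g1 gA gK]]; exists g; split=> // t /gK /KK. Qed.

Lemma within_reparam (A : set R) (u : R -> R) (k : R -> R[i]^o) :
  continuous u -> (forall x, A x -> 0 <= u x <= 1) ->
  {within `[0, 1], continuous k} -> {within A, continuous (k \o u)}.
Proof.
move=> uc uA kc; apply/subspace_continuousP => x Ax.
apply: (@cvg_comp _ _ _ u k _ (within `[0, 1] (nbhs (u x)))).
  move=> V hV; have hU := uc x _ hV.
  change (nbhs x (fun y => A y -> V (u y))).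
  apply: (@filterS _ (nbhs x) _ _ _ _ hU) => y /= h Ay.
  by apply: h; rewrite /= in_itv /= uA.
by move/subspace_continuousP: kc; apply; rewrite /= in_itv /= uA.
Qed.

Lemma affine_continuous (a b : R) : continuous (fun t => a * t + b).
Proof.
move=> t; apply: cvgD; last exact: cvg_cst.
by apply: cvgMl_tmp; exact: cvg_id.
Qed.

Lemma joined_sym K p q : joined K p q -> joined K q p.
Proof.
move=> [g [gc g0 g1 gA gK]]; exists (g \o (fun t => (- 1) * t + 1)); split=> /=.
- apply: within_reparam => //; first exact: affine_continuous.
  by move=> x; rewrite /= in_itv /= => /andP[? ?]; apply/andP; split; rlra.
- by rewrite mulr0 add0r.
- by rewrite mulr1 addNr.
- by move=> t /andP[? ?]; apply: gA; apply/andP; split; rlra.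
- by move=> t /andP[? ?]; apply: gK; apply/andP; split; rlra.
Qed.

Lemma joined_trans K p q p' : annulus q -> joined K p q -> joined K q p' -> joined K p p'.
Proof.
move=> qA [g [gc g0 g1 gA gK]] [h [hc h0 h1 hA hK]].
pose f t := if t <= 2^-1 then g (2 * t + 0) else h (2 * t + (- 1)).
have fE t : 2^-1 <= t -> f t = h (2 * t + (- 1)).
  rewrite /f le_eqVlt => /predU1P[<-|]; last by case: leP.
  by rewrite lexx addr0 divff ?pnatr_eq0 // subrr g1 h0.
have fE0 t : t <= 2^-1 -> f t = g (2 * t + 0) by rewrite /f => ->.
exists f; split.
- have -> : `[0, 1]%classic = `[0, 2^-1]%classic `|` `[2^-1, 1]%classic :> set R.
    apply/seteqP; split=> x; rewrite /= !in_itv /=.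
      by case: (leP x 2^-1) => ? /andP[? ?]; [left|right]; apply/andP; split; rlra.
    by case=> /andP[? ?]; apply/andP; split; rlra.
  apply: withinU_continuous; [exact: itv_closed|exact: itv_closed| |].
    apply: (@subspace_eq_continuous _ _ _ (g \o (fun t => 2 * t + 0))).
      by move=> x; rewrite inE /= in_itv /= => /andP[_ x2]; exact: (esym (fE0 _ x2)).
    apply: within_reparam => //; first exact: affine_continuous.
    by move=> x; rewrite /= in_itv /= => /andP[? ?]; apply/andP; split; rlra.
  apply: (@subspace_eq_continuous _ _ _ (h \o (fun t => 2 * t + (- 1)))).
    by move=> x; rewrite inE /= in_itv /= => /andP[x2 _]; exact: (esym (fE _ x2)).
  apply: within_reparam => //; first exact: affine_continuous.
  by move=> x; rewrite /= in_itv /= => /andP[? ?]; apply/andP; split; rlra.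
- by rewrite fE0 ?invr_ge0 ?ler0n // mulr0 add0r.
- by rewrite fE ?mulr1 -?h1; [congr h; rlra|rlra].
- move=> t /andP[t0 t1]; case: (ltrgtP t 2^-1) => t2.
  + by rewrite fE0 ?ltW //; apply: gA; apply/andP; split; rlra.
  + by rewrite fE ?ltW //; apply: hA; apply/andP; split; rlra.
  + by rewrite fE0 t2 // addr0 divff ?pnatr_eq0 // g1.
- move=> t /andP[t0 t1]; case: (leP t 2^-1) => t2.
  + by rewrite fE0 //; apply: gK; apply/andP; split; rlra.
  + by rewrite fE ?ltW //; apply: hK; apply/andP; split; rlra.
Qed.
End ComplexPlane.

(** * Gluing annular diagrams *)

Section AnnularProduct.
Local Open Scope ring_scope.
Variables (R : realType) (n : nat).
Local Notation cn := (@Normc.normc R).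
Local Notation C := (R[i]^o).
Implicit Types (x y : vertex n) (xi eta : partsg n) (t : R).

Definition ang (x : R) : R := 2 * pi * x / n%:R.

Definition radius x : R := if x is inl _ then 1 else 2.

Lemma boundary_pointE x : boundary_point R x = polar (radius x) (ang (idx x)%:R).
Proof.
case: x => k; rewrite /boundary_point /polar /ang /= ?mul1r //.
by congr (_ * _); rewrite rmorph_nat.
Qed.

Lemma polar_ang_inj (r r' x y : R) : (0 < n)%N -> 0 < r -> 0 < r' -> `|x - y| < n%:R ->
  polar r (ang x) = polar r' (ang y) -> r = r' /\ x = y.
Proof.
move=> n0 r0 r0' xy /(polar_inj r0 r0')[-> h]; split=> //.
have nn : 0 < n%:R :> R by rewrite ltr0n.
have p0 : 0 < 2 * pi :> R by rewrite mulr_gt0 // pi_gt0.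
have : ang x = ang y.
  apply: h; rewrite /ang -mulrBl -mulrBr normrM normrM (gtr0_norm p0).
  rewrite [`|n%:R^-1|]gtr0_norm ?invr_gt0 // ltr_pdivrMr // -[pi *+ 2]mulr_natl.
  by rewrite ltr_pM2l.
by rewrite /ang => /(divIf (lt0r_neq0 nn))/(mulfI (lt0r_neq0 p0)).
Qed.

Lemma polar_angle_inj r r' (k l : 'I_n) : 0 < r -> 0 < r' ->
  polar r (ang k%:R) = polar r' (ang l%:R) -> r = r' /\ k = l.
Proof.
move=> r0 r0'; have n0 : (0 < n)%N by case: k => k; lia.
have kl : `|k%:R - l%:R| < n%:R :> R.
  have := ltn_ord k; have := ltn_ord l; rewrite -!(ltr_nat R) => hl hk.
  have := ler0n R k; have := ler0n R l => l0 k0.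
  by rewrite ltr_norml; apply/andP; split; rlra.
move=> /(polar_ang_inj n0 r0 r0' kl)[-> /eqP].
by rewrite eqr_nat => /eqP/val_inj.
Qed.

Definition class xi x : {set vertex n} := [set y | related xi x y]%SET.

Lemma class_eq xi x y : related xi x y -> class xi x = class xi y.
Proof.
move=> xy; apply/setP => z; rewrite !inE; apply/idP/idP => h.
  exact: related_trans (related_sym xy) h.
exact: related_trans xy h.
Qed.

Lemma class_blocks xi x : class xi x \in blocks xi.
Proof. by apply/blocksP; exists x. Qed.

Definition unit_itv t := 0 <= t <= 1.

Lemma string_cn x y (g : R -> C) t : is_string x y g -> unit_itv t ->
  1 <= cn (g t) <= 2 /\ (cn (g t) = 1 \/ cn (g t) = 2 ->
    g t = boundary_point R x \/ g t = boundary_point R y).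
Proof.
move=> [gc g0 g1 gA] /andP[t0 t1].
have bp (z : vertex n) : 1 <= cn (boundary_point R z) <= 2.
  by rewrite boundary_pointE cn_polar; case: z => k /=; rlra.
have [->|t0'] := eqVneq t 0; first by rewrite g0; split=> //; left.
have [->|t1'] := eqVneq t 1; first by rewrite g1; split=> //; right.
have /gA/annulusE/andP[h1 h2] : 0 < t < 1.
  by apply/andP; split; rewrite lt_neqAle ?t0 ?t1 ?andbT // eq_sym.
by split; [apply/andP; split; rlra|case=> h; exfalso; rlra].
Qed.

Section Layer.
Variables (zeta : partsg n) (g : {set vertex n} -> R -> C) (b : R).
Hypotheses (bz : brauer n zeta) (gz : annular_diagram zeta g).
Hypothesis b12 : 2^-1 <= b <= 1.

Definition trace x : set C :=
  [set z | exists2 t, unit_itv t & z = radial b (g (class zeta x) t)].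

Lemma string_ends x : exists y z, [/\ related zeta x y, related zeta x z &
  is_string y z (g (class zeta x))].
Proof.
have [y [z [yz E S]]] := gz (class_blocks zeta x); exists y, z; split=> //.
  by have : y \in class zeta x; [rewrite E !inE eqxx|rewrite inE].
by have : z \in class zeta x; [rewrite E !inE eqxx orbT|rewrite inE].
Qed.

Lemma trace_cn x t : unit_itv t -> 1 <= cn (g (class zeta x) t) <= 2.
Proof. by move=> ht; have [y [z [_ _ S]]] := string_ends x; have [] := string_cn S ht. Qed.

Lemma joined_layer x y : related zeta x y -> x != y ->
  joined (trace x) (radial b (boundary_point R x)) (radial b (boundary_point R y)).
Proof.
move=> xy nxy; have [u [v [uv E S]]] := gz (class_blocks zeta x).
have xE : x \in class zeta x by rewrite inE related_refl.
have yE : y \in class zeta x by rewrite inE.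
have J : joined (trace x) (radial b (boundary_point R u)) (radial b (boundary_point R v)).
  have [gc g0 g1 gA] := S.
  exists (radial b \o g (class zeta x)); split.
  - apply: within_continuous_comp gc => z; rewrite inE => -[t]; rewrite /= in_itv /= => ht <-.
    have [/andP[c1 _] _] := string_cn S ht.
    by apply: radial_continuous; apply: cn_gt0_neq0; rlra.
  - by rewrite /= g0.
  - by rewrite /= g1.
  - move=> t /gA/annulusE/andP[c1 c2]; apply/annulusE.
    have /andP[b1 b2] := b12.
    by rewrite cn_radial; [apply/andP; split; rlra|rlra|rlra].
  - by move=> t ht; exists t.
move: xE yE; rewrite E !inE => /orP[]/eqP xu /orP[]/eqP yv; subst; rewrite ?eqxx // in nxy *.
exact: joined_sym.
Qed.
End Layer.

Section Product.
Variables (xi eta : partsg n) (g h : {set vertex n} -> R -> C).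
Hypotheses (bxi : brauer n xi) (beta : brauer n eta).
Hypotheses (gxi : annular_diagram xi g) (heta : annular_diagram eta h).
Hypotheses (dxi : disjoint_strings xi g) (deta : disjoint_strings eta h).

Local Notation adj := (fun u v => (u, v) \in stack xi eta).

Definition point3 (u : vertex3 n) : C :=
  match u with
  | inl (inl k) => polar 1 (ang k%:R)
  | inl (inr k) => polar (3 / 2) (ang k%:R)
  | inr k => polar 2 (ang k%:R)
  end.

Lemma point3_top x : point3 (emb_top x) = radial 2^-1 (boundary_point R x).
Proof.
by rewrite boundary_pointE; case: x => k /=; rewrite radial_polar //; congr polar; rlra.
Qed.

Lemma point3_bot x : point3 (emb_bot x) = radial 1 (boundary_point R x).
Proof.
by rewrite boundary_pointE; case: x => k /=; rewrite radial_polar //; congr polar; rlra.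
Qed.

Lemma point3_out x : point3 (emb_out x) = boundary_point R x.
Proof. by rewrite boundary_pointE; case: x. Qed.

(** The room for the string of the product that ends at w: the string is drawn
    inside it by [joined_path], and different strings are disjoint because
    different components are ([component_connect]). *)
Definition component (w : vertex3 n) : set C := [set z |
  (exists2 a, connect adj (emb_top a) w & trace xi g 2^-1 a z) \/
  (exists2 a, connect adj (emb_bot a) w & trace eta h 1 a z)].

Let sc : connect_sym adj.
Proof. by apply: sym_connect_sym => u v; exact: stack_sym. Qed.

Lemma connect_top a c : related xi a c -> connect adj (emb_top a) (emb_top c).
Proof.
by move=> ac; apply: connect1; rewrite inE; apply/orP; left; apply/imsetP; exists (a, c).
Qed.

Lemma connect_bot a c : related eta a c -> connect adj (emb_bot a) (emb_bot c).
Proof.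
by move=> ac; apply: connect1; rewrite inE; apply/orP; right; apply/imsetP; exists (a, c).
Qed.

Lemma joined_edge w u v : adj u v -> u != v -> connect adj u w ->
  joined (component w) (point3 u) (point3 v).
Proof.
rewrite /stack /= !inE => /orP[]/imsetP[[x y] /= xy [-> ->]] nxy uw.
- rewrite !point3_top; apply: (@sub_joined _ (trace xi g 2^-1 x)).
    by move=> z xz; left; exists x.
  by apply: joined_layer => //; first [by apply: contraNneq nxy => -> | by apply/andP; split; rlra].
- rewrite !point3_bot; apply: (@sub_joined _ (trace eta h 1 x)).
    by move=> z xz; right; exists x.
  by apply: joined_layer => //; first [by apply: contraNneq nxy => -> | by apply/andP; split; rlra].
Qed.

(** Inner vertices of the path lie on the middle circle, hence in the open
    annulus, so that the concatenated string meets the boundary only at its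
    ends. *)
Lemma joined_path w u p : (0 < size p)%N -> path adj u p -> uniq (u :: p) ->
  (forall i, (i < (size p).-1)%N -> exists k, nth u p i = inl (inr k)) ->
  connect adj u w -> joined (component w) (point3 u) (point3 (last u p)).
Proof.
elim: p u => // v p IH u _ /= /andP[uv vp] /andP[unp up] mid uw.
have uv' : u != v by apply: contraNneq unp => ->; rewrite mem_head.
have E := joined_edge uv uv' uw.
case: p => [//|v' p] in IH vp unp up mid *.
have vw : connect adj v w by apply: connect_trans uw; rewrite sc; exact: connect1.
apply: joined_trans E (IH v _ _ _ _ _) => //.
- have [k /= ->] := mid 0%N isT; apply/annulusE.
  by rewrite cn_polar; rlra.
- move=> i ip; have [k /= kE] := mid i.+1 ip; exists k.
  by rewrite -kE; apply: set_nth_default; move: ip => /=; lia.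
Qed.

(** Strings of the same factor are disjoint unless they are equal; strings of
    different factors can meet only on the middle circle, at a common end. *)
Lemma component_connect w w' z : component w z -> component w' z -> connect adj w w'.
Proof.
have layers a a' : trace xi g 2^-1 a z -> trace eta h 1 a' z ->
    connect adj (emb_top a) (emb_bot a').
  move=> [t ht zE] [t' ht' zE'].
  have /andP[c1 c2] := trace_cn gxi a ht.
  have /andP[c1' c2'] := trace_cn heta a' ht'.
  have : cn z = cn (g (class xi a) t) / 2 + 2^-1 by rewrite zE cn_radial; rlra.
  have : cn z = cn (h (class eta a') t') / 2 + 1 by rewrite zE' cn_radial; rlra.
  move=> e1 e2.
  have [c [ac cE]] : exists c, related xi a c /\ g (class xi a) t = boundary_point R c.
    have [y [y' [ay ay' S]]] := string_ends gxi a.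
    have [_ []] := string_cn S ht; first by right; rlra.
      by exists y.
    by exists y'.
  have [d [ad dE]] : exists d, related eta a' d /\ h (class eta a') t' = boundary_point R d.
    have [y [y' [ay ay' S]]] := string_ends heta a'.
    have [_ []] := string_cn S ht'; first by left; rlra.
      by exists y.
    by exists y'.
  have rc : radius c = 2.
    have : cn (g (class xi a) t) = radius c.
      by rewrite cE boundary_pointE cn_polar //; case: (c) => k /=; rlra.
    by move=> ?; rlra.
  have rd : radius d = 1.
    have : cn (h (class eta a') t') = radius d.
      by rewrite dE boundary_pointE cn_polar //; case: (d) => k /=; rlra.
    by move=> ?; rlra.
  case: c rc ac cE => k rc ac cE; first by exfalso; move: rc => /= rc; rlra.
  case: d rd ad dE => l rd ad dE; last by exfalso; move: rd => /= rd; rlra.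
  have : point3 (emb_top (inr k)) = point3 (emb_bot (inl l)).
    by rewrite point3_top point3_bot -cE -dE -zE -zE'.
  move=> /= /polar_angle_inj[]; [by rlra|by rlra|move=> _ kl].
  apply: connect_trans (connect_top ac) _; rewrite sc /= kl.
  exact: connect_bot ad.
have same (zeta : partsg n) (k : {set vertex n} -> R -> C) (b : R) a a' : 2^-1 <= b <= 1 ->
    annular_diagram zeta k -> disjoint_strings zeta k ->
    trace zeta k b a z -> trace zeta k b a' z -> related zeta a a'.
  move=> /andP[b1 b2] kz dk [t ht zE] [t' ht' zE'].
  have /andP[c1 c2] := trace_cn kz a ht.
  have /andP[c1' c2'] := trace_cn kz a' ht'.
  have E : k (class zeta a) t = k (class zeta a') t'.
    by apply: (@radial_inj _ b); [rlra|rlra|rlra|rewrite -zE -zE'].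
  have [aa|naa] := eqVneq (class zeta a) (class zeta a').
    have : a' \in class zeta a' by rewrite inE related_refl.
    by rewrite -aa inE.
  have D := dk _ _ (class_blocks zeta a) (class_blocks zeta a') naa.
  have : set0 (k (class zeta a) t).
    rewrite -D; split; first by exists t; rewrite //= in_itv.
    by rewrite E; exists t'; rewrite //= in_itv.
  by [].
case=> [[a aw az]|[a aw az]] [[a' aw' az']|[a' aw' az']].
- apply: connect_trans aw'; rewrite sc in aw; apply: connect_trans aw _.
  apply: connect_top; apply: same az az' => //; apply/andP; split; rlra.
- by rewrite sc in aw; apply: connect_trans aw _; apply: connect_trans (layers _ _ az az') aw'.
- rewrite sc in aw; apply: connect_trans aw _; apply: connect_trans aw'.
  by rewrite sc; exact: layers.
- apply: connect_trans aw'; rewrite sc in aw; apply: connect_trans aw _.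
  apply: connect_bot; apply: same az az' => //; apply/andP; split; rlra.
Qed.

Lemma annular_product : annular R n (xi * eta)%g.
Proof.
split; first exact: brauer_mul.
have /choice[k kP] (B : {set vertex n}) : exists k : R -> C, B \in blocks (xi * eta)%g ->
    exists x y, [/\ x != y, B = [set x; y]%SET, is_string x y k &
      forall t, unit_itv t -> component (emb_out x) (k t)].
  have [/blocksP[x ->]|nB] := boolP (B \in blocks (xi * eta)%g); last by exists (fun=> 0).
  have [y [p [xy E [pp lp] mid up]]] := product_block bxi beta x.
  have p0 : (0 < size p)%N.
    by case: (p) lp => //= /emb_out_inj h0; rewrite h0 eqxx in xy.
  have [k [kc k0 k1 kA kK]] := joined_path p0 pp up mid (connect0 _ _).
  exists k => _; exists x, y; split=> //.
  by split=> //; rewrite ?k0 ?k1 ?lp point3_out.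
exists k; split=> [B /kP[x [y [xy BE S _]]]|B B' BB BB' nB]; first by exists x, y.
apply/seteqP; split=> // z [[t ht zt] [t' ht' zt']]; rewrite /= !in_itv /= in ht ht'.
have [x [y [xy BE S K]]] := kP _ BB; have [x' [y' [xy' BE' S' K']]] := kP _ BB'.
have := K _ ht; have := K' _ ht'; rewrite zt zt' => h1 h2.
have xx' : related (xi * eta)%g x x' by rewrite /related inE; exact: component_connect h2 h1.
case/negP: nB; apply/eqP.
have cls D u v : D \in blocks (xi * eta)%g -> D = [set u; v]%SET -> D = class (xi * eta)%g u.
  move=> /blocksP[w wE] DE; rewrite wE; apply: class_eq.
  by have : u \in D; [rewrite DE !inE eqxx|rewrite wE inE].
by rewrite (cls _ _ _ BB BE) (cls _ _ _ BB' BE') (class_eq xx').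
Qed.
End Product.

Lemma annular_mul : subsemigroup (annular R n).
Proof.
move=> xi eta [bxi [g [gxi dxi]]] [beta [h [heta deta]]].
exact: annular_product dxi deta.
Qed.
End AnnularProduct.

(** * Rotations, hooks and the complexity *)

Section Generators.
Local Open Scope ring_scope.
Variables (R : realType) (n : nat).
Local Notation C := (R[i]^o).

(** A diagram drawn by strings that are indexed by a finite type instead of the
    set of blocks. *)
Lemma annular_strings (xi : partsg n) (I : finType) (s e : I -> vertex n) (c : I -> R -> C) :
  (forall i, s i != e i) -> (forall x, exists i, x = s i \/ x = e i) ->
  (forall i y, related xi (s i) y = (y == s i) || (y == e i)) ->
  (forall i, is_string (s i) (e i) (c i)) ->
  (forall i j t t', unit_itv t -> unit_itv t' -> c i t = c j t' -> i = j) ->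
  annular R n xi.
Proof.
move=> se cover rel str disj.
have blk B : B \in blocks xi -> exists i, B = [set s i; e i]%SET.
  case/blocksP => x ->; have [i xi'] := cover x; exists i.
  have six : related xi (s i) x by rewrite rel; case: xi' => ->; rewrite eqxx ?orbT.
  rewrite -/(class xi x) -(class_eq six).
  by apply/setP => y; rewrite !inE rel.
split=> [B /blk[i ->]|]; first by rewrite cards2 se.
have /choice[g gP] (B : {set vertex n}) : exists k : R -> C, B \in blocks xi ->
    exists i, B = [set s i; e i]%SET /\ k = c i.
  have [/blk[i iE]|nB] := boolP (B \in blocks xi); last by exists (fun=> 0).
  by exists (c i) => _; exists i.
exists g; split=> [B /gP[i [-> ->]]|B B' /gP[i [BE ->]] /gP[j [BE' ->]] nB].
  by exists (s i), (e i).
apply/seteqP; split=> // z [[t ht <-] [t' ht' E]].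
rewrite /= !in_itv /= in ht ht'; case/negP: nB.
by rewrite BE BE' (disj _ _ _ _ ht' ht E).
Qed.

Lemma polar_string (x y : vertex n) (r a : R -> R) : continuous r -> continuous a ->
  polar (r 0) (a 0) = boundary_point R x -> polar (r 1) (a 1) = boundary_point R y ->
  (forall t, 0 < t < 1 -> 1 < r t < 2) ->
  is_string x y (fun t => polar (r t) (a t)).
Proof.
move=> cr ca p0 p1 rA; split=> //; first exact/continuous_subspaceT/polar_continuous.
move=> t /rA/andP[r1 r2]; apply/annulusE; rewrite cn_polar ?r1 //.
by apply: ltW; apply: lt_trans r1.
Qed.

Lemma ang_continuous (a b : R) : continuous (fun t : R => ang n (a * t + b)).
Proof.
have -> : (fun t => ang n (a * t + b)) = (fun t => (2 * pi / n%:R * a) * t + ang n b).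
  by apply/funext => t; rewrite /ang; ring.
exact: affine_continuous.
Qed.

Lemma bump_continuous (a b : R) : continuous (fun t : R => a * (t * (1 - t)) + b).
Proof.
move=> t; apply: cvgD; last exact: cvg_cst.
apply: cvgMl_tmp; apply: cvgM; first exact: cvg_id.
by apply: cvgB; [exact: cvg_cst|exact: cvg_id].
Qed.

Lemma rotation_annular : (1 < n)%N -> annular R n (turn_diag n 0 1).
Proof.
move=> n1; have n0 : (0 < n)%N by lia.
have ltS (i : 'I_n) : (turn n 0 1 i < n)%N by have := ltn_ord i; rewrite /turn; case: ifP; lia.
pose nxt (i : 'I_n) : 'I_n := Ordinal (ltS i).
apply: (@annular_strings _ 'I_n (fun i => inl i) (fun i => inr (nxt i))
  (fun i t => polar (1 * t + 1) (ang n (1 * t + i%:R)))) => //.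
- move=> [k|l]; first by exists k; left.
  have lp : (turn n 0 (n - 1) l < n)%N by have := ltn_ord l; rewrite /turn; case: ifP; lia.
  exists (Ordinal lp); right; congr inr; apply: val_inj => /=.
  by have := ltn_ord l; rewrite /turn; do 2!case: ifP; lia.
- move=> i [l|l]; rewrite related_kernel; apply/eqP/orP => /=.
  + move=> -[E]; left; apply/eqP; congr inl; apply: val_inj => /=.
    by have := ltn_ord i; have := ltn_ord l; move: E; rewrite /turn; do 2!case: ifP; lia.
  + by case=> /eqP // [->].
  + by move=> -[E]; right; apply/eqP; congr inr; apply: val_inj.
  + by case=> /eqP // [->].
- move=> i; apply: polar_string.
  + exact: affine_continuous.
  + exact: ang_continuous.
  + by rewrite boundary_pointE /= !mul1r !add0r.
  + rewrite boundary_pointE /= mul1r [1 + 1]/(2%:R).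
    rewrite /turn; case: ifP => h; first by rewrite natrD addrC.
    have E : (i + 1 = n)%N by have := ltn_ord i; lia.
    have -> : 1 + i%:R = n%:R :> R by rewrite addrC natr1; congr (_%:R); lia.
    have -> : (i + 1 - (n - 0.*2) = 0)%N by lia.
    rewrite /ang mulr0 mul0r mulfK ?pnatr_eq0 -?lt0n // mulr_natl.
    by rewrite /polar /cis cos2pi sin2pi cos0 sin0.
  + by move=> t /andP[? ?]; apply/andP; split; rlra.
- move=> i j t t' /andP[t0 t1] /andP[t0' t1'] E.
  have r0 : 0 < 1 * t + 1 by rlra.
  have r0' : 0 < 1 * t' + 1 by rlra.
  have [rr _] := polar_inj r0 r0' E; have tt : t = t' by rlra.
  move: E; rewrite tt => /(polar_ang_inj n0 r0' r0')[|_ /addrI/eqP].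
    rewrite opprD addrACA subrr add0r ltr_norml.
    have := ltn_ord i; have := ltn_ord j; rewrite -!(ltr_nat R) => hj hi.
    have := ler0n R i; have := ler0n R j => j0 i0; apply/andP; split; rlra.
  by rewrite eqr_nat => /eqP/val_inj.
Qed.

Lemma hook_annular : (2 < n)%N -> annular R n (turn_diag n 1 0).
Proof.
move=> n2; have n0 : (0 < n)%N by lia.
have lt0 : (0 < n)%N by lia. have lt1 : (1 < n)%N by lia.
pose i0 := Ordinal lt0; pose i1 := Ordinal lt1.
(* string 0 is the hook on the inner circle, string 1 the one on the outer circle *)
pose s (i : 'I_n) : vertex n := if i == 0%N :> nat then inl i0
  else if i == 1%N :> nat then inr i0 else inl i.
pose e (i : 'I_n) : vertex n := if i == 0%N :> nat then inl i1
  else if i == 1%N :> nat then inr i1 else inr i.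
pose r (i : 'I_n) (t : R) := if i == 0%N :> nat then 1 * (t * (1 - t)) + 1
  else if i == 1%N :> nat then (- 1) * (t * (1 - t)) + 2 else 1 * t + 1.
pose a (i : 'I_n) (t : R) := if (i < 2)%N then 1 * t + 0 else 0 * t + i%:R.
have turn0n k : (k < n)%N -> turn n 1 0 k = k by move=> kn; rewrite /turn addn0 kn.
have quad (t : R) : 0 <= t <= 1 -> 0 <= t * (1 - t) <= 4^-1.
  move=> /andP[t0 t1]; apply/andP; split; first by apply: mulr_ge0; rlra.
  by have := sqr_ge0 (t - 2^-1); rewrite expr2; rlra.
have rpos i t : 0 <= t <= 1 -> 0 < r i t.
  move=> t01; have /andP[q1 q2] := quad _ t01; move/andP: t01 => [t0 t1].
  by rewrite /r; case: ifP => _; [|case: ifP => _]; rlra.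
apply: (@annular_strings _ 'I_n s e (fun i t => polar (r i t) (ang n (a i t)))).
- by move=> i; rewrite /s /e; case: ifP => _; [|case: ifP => _].
- have small (k : 'I_n) : (k < 2)%N -> k = i0 \/ k = i1.
    by case: k => [[|[|k]] hk] //= _; [left|right]; apply: val_inj.
  move=> [k|k]; have [/small[->|->]|k2] := ltnP k 2.
  + by exists i0; left.
  + by exists i0; right.
  + exists k; left; rewrite /s; case: eqP => [h|_]; first by lia.
    by case: eqP => [h|_] //; lia.
  + by exists i1; left.
  + by exists i1; right.
  + exists k; right; rewrite /e; case: eqP => [h|_]; first by lia.
    by case: eqP => [h|_] //; lia.
- move=> i y; rewrite related_kernel; apply/eqP/orP; last first.
    case=> /eqP -> //; rewrite /s /e; case: eqP => [//|/eqP h0]; case: eqP => [//|/eqP h1] /=.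
    by have -> : (i < 1.*2)%N = false by [lia]; rewrite turn0n.
  rewrite /s /e; case: eqP => [_|/eqP h0]; [|case: eqP => [_|/eqP h1]].
  + case: y => k /=; case: ifP => [k2 _|k2] //.
    by case: k k2 => [[|[|k]] hk] //= _; [left|right]; apply/eqP; congr inl; apply: val_inj.
  + case: y => k /=; case: ifP => [k2 _|k2] //.
    by case: k k2 => [[|[|k]] hk] //= _; [left|right]; apply/eqP; congr inr; apply: val_inj.
  + have i2 : (i < 1.*2)%N = false by lia.
    case: y => k /=; rewrite i2 ?turn0n //; case: ifP => [//|k2]; rewrite ?turn0n // => -[E].
      by left; apply/eqP; congr inl; apply: val_inj.
    by right; apply/eqP; congr inr; apply: val_inj.
- move=> i; rewrite /s /e /r /a.
  have [i_0|n_0] := eqVneq (i : nat) 0%N.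
    have -> : (i < 2)%N by lia.
    apply: polar_string; [exact: bump_continuous|exact: ang_continuous|..].
    + by rewrite boundary_pointE /= !mulr0 mul0r mulr0 add0r addr0.
    + by rewrite boundary_pointE /= subrr !mulr0 add0r addr0 mulr1.
    + move=> t /andP[t0 t1]; have t01 : 0 <= t <= 1 by apply/andP; split; rlra.
      have /andP[q1 q2] := quad _ t01.
      by have : 0 < t * (1 - t) by [apply: mulr_gt0; rlra] => q; apply/andP; split; rlra.
  have [i_1|n_1] := eqVneq (i : nat) 1%N.
    have -> : (i < 2)%N by lia.
    apply: polar_string; [exact: bump_continuous|exact: ang_continuous|..].
    + by rewrite boundary_pointE /= !mulr0 mul0r mulr0 add0r addr0.
    + by rewrite boundary_pointE /= subrr !mulr0 add0r addr0 mulr1.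
    + move=> t /andP[t0 t1]; have t01 : 0 <= t <= 1 by apply/andP; split; rlra.
      have /andP[q1 q2] := quad _ t01.
      by have : 0 < t * (1 - t) by [apply: mulr_gt0; rlra] => q; apply/andP; split; rlra.
  have -> : (i < 2)%N = false by lia.
  apply: polar_string; [exact: affine_continuous|exact: ang_continuous|..].
  + by rewrite boundary_pointE /= mulr0 mul0r !add0r.
  + by rewrite boundary_pointE /= mulr1 mul0r add0r.
  + by move=> t /andP[? ?]; apply/andP; split; rlra.
- move=> i j t t' t01 t01' E.
  have arange k u : 0 <= u <= 1 -> 0 <= a k u < n%:R.
    move=> /andP[u0 u1]; rewrite /a; have := ltn_ord k; rewrite -(ltr_nat R) => hk.
    have hn : 2 < n%:R :> R by rewrite ltr_nat.
    by have := ler0n R k => k0; case: ifP => _; apply/andP; split; rlra.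
  have /andP[a0 a1] := arange i t t01; have /andP[a0' a1'] := arange j t' t01'.
  have dist : `|a i t - a j t'| < n%:R by rewrite ltr_norml; apply/andP; split; rlra.
  have [rr aa] := polar_ang_inj n0 (rpos i t t01) (rpos j t' t01') dist E.
  have /andP[q1 q2] := quad _ t01; have /andP[q1' q2'] := quad _ t01'.
  move: t01 t01' => /andP[t0 t1] /andP[t0' t1'].
  apply: val_inj => /=.
  have mixed (k l : 'I_n) (u v : R) : (k < 2)%N -> (2 <= l)%N -> u <= 1 -> a k u = a l v -> False.
    rewrite /a => k2 l2 u1; rewrite k2 ltnNge l2 /= => au.
    by have : 2%:R <= l%:R :> R by [rewrite ler_nat]; rlra.
  have [i2|i2] := ltnP i 2; have [j2|j2] := ltnP j 2.
  + move: rr; rewrite /r; case: i j i2 j2 {E aa a0 a1 a0' a1' dist} => [[|[|i]] hi] [[|[|j]] hj] //= _ _ rr.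
      by exfalso; rlra.
    by exfalso; rlra.
  + by have := mixed i j t t' i2 j2 t1 aa.
  + by have := mixed j i t' t j2 i2 t1' (esym aa).
  + move: aa; rewrite /a; have -> : (i < 2)%N = false by rewrite ltnNge i2.
    have -> : (j < 2)%N = false by rewrite ltnNge j2.
    rewrite !mul0r !add0r => /eqP.
    by rewrite eqr_nat => /eqP.
Qed.
End Generators.

Theorem theorem4p11 (R : realType) (n : nat) (hn : (0 < n)%N) :
  has_complexity (annular R (2 * n - 1)) (n - 1).
Proof.
have annular_brauer : annular R (2 * n - 1) `<=` brauer (2 * n - 1) by move=> xi [].
split.
  have [W kW dW] := brauer_upper hn; exists W => //.
  exact: sub_divides annular_brauer (@annular_mul R _) dW.
move=> k [W kW dW].
have [->|n1] := eqVneq n 1%N; first by [].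
have : divides_kr_product (@level (2 * n - 1)%N 0%N) k.
  exists W => //; apply: sub_divides dW; last by move=> u v; exact: level_mul.
  move=> u; elim=> [|h|{}u v _ IHu _ IHv].
  - by apply: rotation_annular; lia.
  - by apply: hook_annular; lia.
  - exact: annular_mul.
move/level_complexity; lia.
Qed.
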